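(* Let $p$ be a prime number and let $\epsilon\in(0,1-1/p]$ be a fixed real number. For each $n\ge 1$, let $A_n\in\mathrm{Mat}_n(\mathbb{F}_p)$ be a random matrix whose entries are independent and $\epsilon$-balanced (not necessarily identically distributed). Let $f_1,\ldots,f_r\in\mathbb{F}_p[t]$ be distinct monic, irreducible, nonconstant polynomials. For $1\le i\le r$, let $e_i=e_i(A_n)$ be the power of $f_i$ in the characteristic polynomial $\det(tI_n-A_n)$, i.e. the largest integer $e\ge 0$ such that $f_i^{e}$ divides $\det(tI_n-A_n)$. Then the distribution of the $r$-tuple of non-negative integers $(e_1,\ldots,e_r)$ converges pointwise, as $n\to\infty$, to the product measure $\prod_{i=1}^r\nu_{f_i}$ on $\mathbb{Z}_{\ge 0}^r$, where for all $1\le i\le r$, $$\nu_{f_i}(j)=p^{-j\deg f_i}\prod_{k=j+1}^\infty\left(1-p^{-k\deg f_i}\right),\qquad\forall j\in\mathbb{Z}_{\ge 0}.$$ That is, for all $j_1,\ldots,j_r\in\mathbb{Z}_{\ge 0}$, $\lim_{n\to\infty}\mathbf{P}(e_i(A_n)=j_i\text{ for all }1\le i\le r)=\prod_{i=1}^r\nu_{f_i}(j_i)$.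
   Context: $\mathrm{Mat}_n(\mathbb{F}_p)$ is the set of $n\times n$ matrices over the finite field $\mathbb{F}_p$. A random variable $\xi\in\mathbb{F}_p$ is $\epsilon$-balanced if $\mathbf{P}(\xi=a)\le 1-\epsilon$ for all $a\in\mathbb{F}_p$. *)

(* Defs.v *)
From mathcomp Require Import all_boot all_order all_algebra.
From mathcomp Require Import all_classical all_reals all_analysis.

Set Implicit Arguments.
Unset Strict Implicit.
Unset Printing Implicit Defensive.

Import Order.TTheory GRing.Theory Num.Theory.
Import numFieldNormedType.Exports.

Local Open Scope classical_set_scope.
Local Open Scope ring_scope.

(* The codomain V (here 'F_p) carries the discrete sigma-algebra, so that every
   subset of V is measurable. *)
Definition random_element (d : measure_display)
    (T : measurableType d) (V : Type) (X : T -> V) : Prop :=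
  forall B : set V, measurable (X @^-1` B).

Definition balanced (R : realType) (d : measure_display)
    (T : measurableType d) (P : probability T R) (V : Type)
    (eps : R) (X : T -> V) : Prop :=
  forall a : V, (P (X @^-1` [set a]) <= (1 - eps)%:E)%E.

Definition mutually_independent (R : realType) (d : measure_display)
    (T : measurableType d) (P : probability T R) (I : finType) (V : Type)
    (X : I -> T -> V) : Prop :=
  forall (J : {set I}) (B : I -> set V),
    fine (P [set w | forall k, k \in J -> B k (X k w)])
    = \prod_(k in J) fine (P (X k @^-1` B k)).

(* The bound [e < size q] only makes the range finite; see [multiplicityP]. *)
Definition multiplicity (F : fieldType) (f q : {poly F}) : nat :=
  (\max_(e < size q | (f ^+ e %| q)%R) e)%N.

Lemma multiplicityP (F : fieldType) (f q : {poly F}) (e : nat) :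
  (1 < size f)%N -> q != 0 -> (f ^+ e %| q) = (e <= multiplicity f q)%N.
Proof.
move=> f_gt1 q0.
have f0 : f != 0 by rewrite -size_poly_gt0 ltnW.
apply/idP/idP => [fq|].
  have e_lt : (e < size q)%N.
    rewrite -(prednK (n := size q)) ?size_poly_gt0// ltnS.
    have := dvdp_leq q0 fq; rewrite -ltnS => le_q.
    have le1 : (e <= (size f).-1 * e)%N.
      by apply: leq_pmull; case: (size f) f_gt1 => [|[]].
    apply: (leq_trans le1); rewrite -size_exp.
    by case: (size (f ^+ e)) (size q) le_q => [|m] [|k].
  by rewrite /multiplicity (bigD1 (Ordinal e_lt))//= leq_maxl.
move=> e_le; apply: (@dvdp_trans _ (f ^+ multiplicity f q)).
  exact: dvdp_exp2l.
rewrite /multiplicity; elim/big_ind: _ => // [|m n].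
  by rewrite expr0 dvd1p.
by rewrite /maxn; case: ifP.
Qed.

(* nu f j = p^(- j deg f) * \prod_(k >= j + 1) (1 - p^(- k deg f)); the infinite
   product is the limit of its partial products, which exists by
   [is_cvg_nu_factor]. *)
Definition nu_factor (R : realType) (p : nat) (f : {poly 'F_p}) (j N : nat) : R :=
  \prod_(j.+1 <= k < N) (1 - p%:R ^- (k * (size f).-1)).

Definition nu (R : realType) (p : nat) (f : {poly 'F_p}) (j : nat) : R :=
  p%:R ^- (j * (size f).-1) * limn (nu_factor R f j).

Lemma is_cvg_nu_factor (R : realType) (p : nat) (f : {poly 'F_p}) (j : nat) :
  prime p -> cvgn (nu_factor R f j).
Proof.
move=> p_prime.
have term k : 0 <= 1 - (p%:R : R) ^- (k * (size f).-1) <= 1.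
  have p_ge1 : 1 <= p%:R :> R by rewrite ler1n prime_gt0.
  rewrite subr_ge0 lerBlDr lerDl invr_ge0 exprn_ge0 ?ler0n// andbT.
  by rewrite invf_le1 ?exprn_ege1// exprn_gt0// (lt_le_trans ltr01).
have ge0 N : 0 <= nu_factor R f j N.
  by apply: prodr_ge0 => k _; case/andP: (term k).
apply: nonincreasing_is_cvgn; last first.
  by exists 0 => _ [N _ <-]; exact: ge0.
apply/nonincreasing_seqP => N; rewrite /nu_factor.
case: (leqP j.+1 N) => jN; last by rewrite !big_geq// ltnW.
by rewrite big_nat_recr//= ler_piMr ?ge0//; case/andP: (term N).
Qed.

(* Main.v *)
(* A matrix A turns F^n into a module over F[t], with t acting by v |-> v A.  For
   a fixed square matrix B, let N(B, A) be the number of full-rank U with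
   U A = B U, i.e. of embeddings of the module of B into that of A.

   Universality: E N(B, A) -> 1.  The columns of A are independent, so this is a
   sum over U of products of probabilities P(U a = x).  If every nonzero
   combination of the rows of U has large weight, each of them is F^(-m) up to an
   exponentially small relative error.  The other U are too few to matter: a
   maximal set of k independent light combinations gains only P <= (1 - eps) per
   column, which beats the number of light vectors.

   From moments to the law: put F_j = prod f_i^(j_i).  The tuple (e_i) equals j iff
   there is a (necessarily unique) stable subspace with characteristic polynomial
   F_j whose quotient has no f_i-torsion.  Mobius inversion over semisimple
   submodules expresses the absence of torsion as an alternating series in the
   N(B, A), whose truncation error is bounded by the first omitted term
   (Bonferroni).  The limits of its terms sum by Euler's identity
   sum_k (-1)^k / prod_(a <= k) (q^a - 1) = prod_(k >= 1) (1 - q^(-k)), and the same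
   inversion applied to matrices of size deg F_j counts the matrices with
   characteristic polynomial F_j. *)
Require Import Defs.
From mathcomp Require Import all_boot all_order all_algebra.
From mathcomp Require Import all_classical all_reals all_analysis.
From mathcomp Require Import zify ring lra.

Set Implicit Arguments.
Unset Strict Implicit.
Unset Printing Implicit Defensive.

Import Order.TTheory GRing.Theory Num.Theory.
Import numFieldNormedType.Exports.

Local Open Scope ring_scope.

(** * Matrices and polynomials *)

Section BigMatrix.
Variables (F : finFieldType) (R : Type) (idx : R) (op : Monoid.com_law idx).

(** What shapes the passage from moments to the law is the exchange of [n -> oo] with the
    alternating series. Bonferroni bounds the truncation error by a product [\prod (1 + t_i) - 1],
    and this bound is again a combination of embedding counts. At a fixed truncation level, both the
    main term and the error thus involve finitely many [B], their limits are known, and only then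
    does the level grow. The extension of the semisimple piece by the subspace below it is unknown,
    so its block [C] is summed over. A stable subspace has as many bases as the linear group has
    elements, whence the divisions by [gl_order]. In the universality part the relative error of one
    column accumulates over [n] columns, so equidistribution must hold at an exponential rate in the
    weight. Each nonzero coefficient contracts the squared L2 distance to the uniform law by
    [theta = 1 - eps / p^2]; this comes from a Poincare inequality on the cyclic group instead of
    characters, so that all sums stay real. *)

Lemma big_col_mx m k n (P : pred 'M[F]_(m + k, n)) (G : 'M[F]_(m + k, n) -> R) :
  \big[op/idx]_(U | P U) G U =
  \big[op/idx]_(U1 : 'M[F]_(m, n))
    \big[op/idx]_(U2 : 'M[F]_(k, n) | P (col_mx U1 U2)) G (col_mx U1 U2).
Proof.
rewrite pair_big_dep /=.
rewrite (reindex (fun u : 'M[F]_(m, n) * 'M[F]_(k, n) => col_mx u.1 u.2)) //=.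
exists (fun U => (usubmx U, dsubmx U)) => U _ /=; last by rewrite vsubmxK.
by rewrite col_mxKu col_mxKd; case: U.
Qed.

Lemma big_row_mx m n k (P : pred 'M[F]_(m, n + k)) (G : 'M[F]_(m, n + k) -> R) :
  \big[op/idx]_(U | P U) G U =
  \big[op/idx]_(U1 : 'M[F]_(m, n))
    \big[op/idx]_(U2 : 'M[F]_(m, k) | P (row_mx U1 U2)) G (row_mx U1 U2).
Proof.
rewrite pair_big_dep /=.
rewrite (reindex (fun u : 'M[F]_(m, n) * 'M[F]_(m, k) => row_mx u.1 u.2)) //=.
exists (fun U => (lsubmx U, rsubmx U)) => U _ /=; last by rewrite hsubmxK.
by rewrite row_mxKl row_mxKr; case: U.
Qed.

Lemma big_mulmxl m n (g : 'M[F]_m) (P : pred 'M[F]_(m, n)) G : g \in unitmx ->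
  \big[op/idx]_(U | P U) G U = \big[op/idx]_(U | P (g *m U)) G (g *m U).
Proof.
move=> gu; rewrite (reindex (fun U : 'M[F]_(m, n) => g *m U)) //=.
by exists (fun U => invmx g *m U) => U _; rewrite ?mulKmx ?mulKVmx.
Qed.

Lemma big_mulmxr m n (g : 'M[F]_n) (P : pred 'M[F]_(m, n)) G : g \in unitmx ->
  \big[op/idx]_(U | P U) G U = \big[op/idx]_(U | P (U *m g)) G (U *m g).
Proof.
move=> gu; rewrite (reindex (fun U : 'M[F]_(m, n) => U *m g)) //=.
by exists (fun U => U *m invmx g) => U _; rewrite ?mulmxK ?mulmxKV.
Qed.

Lemma big_conj n (g : 'M[F]_n) (P : pred 'M[F]_n) G : g \in unitmx ->
  \big[op/idx]_(A | P A) G A =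
  \big[op/idx]_(A | P (invmx g *m A *m g)) G (invmx g *m A *m g).
Proof. by move=> gu; rewrite (big_mulmxr _ _ gu) (big_mulmxl (g := invmx g)) ?unitmx_inv. Qed.

End BigMatrix.

Section PolyEval.
Variable F : fieldType.

(* [horner_mx] is only available for matrices of successor size. *)
Definition peval n : 'M[F]_n -> {poly F} -> 'M[F]_n :=
  match n with 0%N => fun _ _ => 0 | n'.+1 => fun A p => horner_mx A p end.

Lemma pevalD n (A : 'M[F]_n) p q : peval A (p + q) = peval A p + peval A q.
Proof. by case: n A => [|n] A; [rewrite [LHS]flatmx0 [RHS]flatmx0|rewrite /= rmorphD]. Qed.

Lemma peval0 n (A : 'M[F]_n) : peval A 0 = 0.
Proof. by case: n A => [|n] A //=; rewrite rmorph0. Qed.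

Lemma pevalN n (A : 'M[F]_n) p : peval A (- p) = - peval A p.
Proof. by apply/eqP; rewrite -addr_eq0 -pevalD addNr peval0. Qed.

Lemma pevalM n (A : 'M[F]_n) p q : peval A (p * q) = peval A p *m peval A q.
Proof. by case: n A => [|n] A; [rewrite [LHS]flatmx0 [RHS]flatmx0|rewrite /= rmorphM]. Qed.

Lemma pevalC n (A : 'M[F]_n) c : peval A c%:P = c%:M.
Proof. by case: n A => [|n] A; [rewrite [LHS]flatmx0 [RHS]flatmx0|rewrite /= horner_mx_C]. Qed.

Lemma pevalX n (A : 'M[F]_n) : peval A 'X = A.
Proof. by case: n A => [|n] A; [rewrite [LHS]flatmx0 [RHS]flatmx0|rewrite /= horner_mx_X]. Qed.

Lemma peval_char n (A : 'M[F]_n) : peval A (char_poly A) = 0.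
Proof. by case: n A => [|n] A //=; rewrite Cayley_Hamilton. Qed.

Lemma peval_inter m n (U : 'M[F]_(m, n)) (A : 'M[F]_n) (B : 'M[F]_m) p :
  U *m A = B *m U -> U *m peval A p = peval B p *m U.
Proof.
move=> UA; elim/poly_ind: p => [|p c IHp].
  by rewrite -polyC0 !pevalC scalar_mxC.
rewrite !pevalD !pevalM !pevalX !pevalC mulmxDr mulmxA IHp -mulmxA UA mulmxA.
by rewrite mulmxDl -scalar_mxC.
Qed.

Lemma det_scalar_sub n (C : 'M[F]_n) (h : {poly F}) :
  \det (h%:M - map_mx polyC C) = char_poly C \Po h.
Proof.
rewrite -[RHS]/(comp_poly h (char_poly C)) -det_map_mx; congr (\det _).
apply/matrixP => i j; rewrite !mxE rmorphB /= comp_polyC rmorphMn /=.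
by rewrite comp_polyX.
Qed.

(** The factor theorem for matrices: [h(t) - h(A)] is divisible by [t - A]. Taking determinants
    shows that [char_poly A] divides [char_poly (peval A h) \Po h]. *)
Lemma peval_factor n (A : 'M[F]_n) (h : {poly F}) :
  exists G : 'M[{poly F}]_n,
    h%:M - map_mx polyC (peval A h) = char_poly_mx A *m G.
Proof.
elim/poly_ind: h => [|h c [G eqG]].
  exists 0; rewrite -polyC0 pevalC mulmx0.
  by apply/matrixP => i j; rewrite !mxE !(polyC0, mul0rn) subr0 ?polyC0.
exists (G *m map_mx polyC A + h%:M).
rewrite mulmxDr mulmxA -eqG mulmxBl /char_poly_mx.
rewrite pevalD pevalM pevalC pevalX map_mxD map_mxM map_scalar_mx /=.
rewrite mulmxBl -scalar_mxM [map_mx _ A *m _]scalar_mxC mulrC.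
rewrite [_ - _ *m map_mx polyC A + _]addrC addrA subrK.
by rewrite [X in X - _](raddfD (@scalar_mx {poly F} n)) opprD addrACA subrr addr0.
Qed.

Lemma comp_poly_modp (chi h : {poly F}) : h %| chi \Po h - (chi`_0)%:P.
Proof.
elim/poly_ind: chi => [|q c _]; first by rewrite comp_poly0 coef0 subrr.
rewrite comp_polyD comp_polyM comp_polyX comp_polyC coefD coefMX coefC /= add0r.
by rewrite addrK dvdp_mulIr.
Qed.

(** If [h(A)] is invertible with characteristic polynomial [chi], the factorization makes
    [char_poly A] divide [chi \Po h]. Modulo [h] the latter is the constant term of [chi], up to
    sign the determinant of [h(A)]; so the gcd divides a nonzero constant, with no extension of
    scalars. *)
Lemma coprimep_char n (A : 'M[F]_n) (h : {poly F}) :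
  (peval A h \in unitmx) = coprimep h (char_poly A).
Proof.
apply/idP/idP => [hA | /Bezout_eq1_coprimepP [[u v] /= uv]]; last first.
  have /(congr1 (peval A)) := uv.
  rewrite pevalD !pevalM peval_char mulmx0 addr0 -polyC1 pevalC.
  by case/mulmx1_unit.
have [G eqG] := peval_factor A h.
have /(congr1 determinant) := eqG; rewrite det_scalar_sub det_mulmx => cpG.
set C := peval A h in hA cpG.
have C0 : (char_poly C)`_0 != 0.
  by rewrite char_poly_det mulf_eq0 signr_eq0 -unitfE -unitmxE.
have : gcdp h (char_poly A) %| ((char_poly C)`_0)%:P.
  have := comp_poly_modp (char_poly C) h; rewrite cpG.
  move=> /(dvdp_trans (dvdp_gcdl h (char_poly A))).
  by rewrite dvdp_subr // dvdp_mulr ?dvdp_gcdr.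
move/(dvdp_leq _); rewrite polyC_eq0 size_polyC C0 => /(_ isT) le1.
rewrite coprimep_def eqn_leq le1 size_poly_gt0 gcdp_eq0 negb_and.
by rewrite (monic_neq0 (char_poly_monic A)) orbT.
Qed.

End PolyEval.

(** * Block form of a matrix along a stable subspace *)

Section Blocks.
Variable F : fieldType.

Lemma char_poly_conj n (g A B : 'M[F]_n) :
  g \in unitmx -> g *m A = B *m g -> char_poly A = char_poly B.
Proof.
move=> gu gA; pose pg := map_mx polyC g.
have pg0 : \det pg != 0 by rewrite det_map_mx polyC_eq0 -unitfE -unitmxE.
apply: (mulfI pg0); rewrite /char_poly -det_mulmx [RHS]mulrC -det_mulmx.
rewrite mulmxBr mulmxBl -!map_mxM gA; congr (\det (_ - _)).
by rewrite -scalar_mxC.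
Qed.

Lemma char_poly_lblock m n (B : 'M[F]_m) C (D : 'M[F]_n) :
  char_poly (block_mx B 0 C D) = char_poly B * char_poly D.
Proof.
rewrite /char_poly /char_poly_mx map_block_mx /= map_mx0.
rewrite scalar_mx_block opp_block_mx add_block_mx oppr0 addr0.
exact: det_lblock.
Qed.

Lemma unit_lblock m n (B : 'M[F]_m) C (D : 'M[F]_n) :
  (block_mx B 0 C D \in unitmx) = (B \in unitmx) && (D \in unitmx).
Proof. by rewrite !unitmxE det_lblock unitrM. Qed.

Lemma row_free_kerP m n (A : 'M[F]_(m, n)) :
  reflect (forall v : 'rV_m, v *m A = 0 -> v = 0) (row_free A).
Proof.
apply: (iffP idP) => [fA v /eqP|]; last exact: inj_row_free.
by rewrite mulmx_free_eq0 // => /eqP.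
Qed.

Lemma row_free_lblock m k n (C : 'M[F]_(k, m)) (D : 'M[F]_(k, n)) :
  row_free (block_mx 1%:M 0 C D) = row_free D.
Proof.
apply/row_free_kerP/row_free_kerP => [inj v vD|inj v].
  have /inj/(congr1 rsubmx) : row_mx (- (v *m C)) v *m block_mx 1%:M 0 C D = 0.
    by rewrite mul_row_block mulmx1 mulmx0 vD addNr addr0 row_mx0.
  by rewrite row_mxKr raddf0.
rewrite -[v]hsubmxK mul_row_block mulmx1 mulmx0 add0r -row_mx0.
case/eq_row_mx => eq1 /inj v2; move: eq1; rewrite v2 mul0mx addr0 => ->.
by rewrite row_mx0.
Qed.

Lemma row_free_colU m k n (U : 'M[F]_(m, n)) (V : 'M[F]_(k, n)) :
  row_free (col_mx U V) -> row_free U.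
Proof.
move/row_free_kerP => inj; apply/row_free_kerP => v vU.
have /inj/(congr1 lsubmx) : row_mx v 0 *m col_mx U V = 0.
  by rewrite mul_row_col vU mul0mx addr0.
by rewrite row_mxKl raddf0.
Qed.

Lemma row_free_colD m k n (U : 'M[F]_(m, n)) (V : 'M[F]_(k, n)) :
  row_free (col_mx U V) -> row_free V.
Proof.
move/row_free_kerP => inj; apply/row_free_kerP => v vV.
have /inj/(congr1 rsubmx) : row_mx 0 v *m col_mx U V = 0.
  by rewrite mul_row_col vV mul0mx addr0.
by rewrite row_mxKr raddf0.
Qed.

Definition compl m n (U : 'M[F]_(m, m + n)) : 'M[F]_(n, m + n) :=
  dsubmx (row_ebase U).

Lemma compl_unit m n (U : 'M[F]_(m, m + n)) :
  row_free U -> col_mx U (compl U) \in unitmx.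
Proof.
move=> Ufree; have rU : \rank U = m by apply/eqP.
have -> : col_mx U (compl U) = block_mx (col_ebase U) 0 0 1%:M *m row_ebase U.
  rewrite -[X in _ = _ *m X]vsubmxK mul_block_col !mul0mx mul1mx addr0 add0r.
  congr col_mx; rewrite -{1}(mulmx_ebase U) rU.
  rewrite pid_mx_row -mulmxA -[X in row_mx _ _ *m X]vsubmxK mul_row_col mul1mx.
  by rewrite mul0mx addr0.
by rewrite unitmx_mul unit_lblock col_ebase_unit unitmx1 row_ebase_unit.
Qed.


(** For a stable [U], the action of [A] on the quotient by the row space of [U], in the basis
    [compl U]. *)
Definition quo m n (U : 'M[F]_(m, m + n)) (A : 'M[F]_(m + n)) : 'M[F]_n :=
  let g := col_mx U (compl U) in drsubmx (g *m A *m invmx g).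

Section Stable.
Variables (m n : nat) (U : 'M[F]_(m, m + n)) (A : 'M[F]_(m + n)) (B : 'M[F]_m).
Hypotheses (Ufree : row_free U) (UA : U *m A = B *m U).
Let g := col_mx U (compl U).

Lemma stable_block : exists C, g *m A = block_mx B 0 C (quo U A) *m g.
Proof.
have gu : g \in unitmx by exact: compl_unit.
set X := g *m A *m invmx g; exists (dlsubmx X).
have -> : g *m A = X *m g by rewrite mulmxKV.
have uX : usubmx X = row_mx B 0.
  apply: (row_free_inj (A := g)); rewrite ?row_free_unit //.
  by rewrite -mul_usub_mx mulmxKV // mul_col_mx col_mxKu UA mul_row_col mul0mx addr0.
congr (_ *m _); rewrite -[X in LHS]submxK /quo -/g -/X /ulsubmx /ursubmx uX.
by rewrite row_mxKl row_mxKr.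
Qed.

Lemma char_poly_quo : char_poly A = char_poly B * char_poly (quo U A).
Proof.
have [C gA] := stable_block.
by rewrite (char_poly_conj _ gA) ?char_poly_lblock // compl_unit.
Qed.

Lemma row_free_col_quo k (Y : 'M[F]_(k, m)) (Z : 'M[F]_(k, n)) :
  row_free (col_mx U (row_mx Y Z *m g)) = row_free Z.
Proof.
rewrite -(row_free_lblock Y); have gu : g \in unitmx by exact: compl_unit.
have -> : col_mx U (row_mx Y Z *m g) = block_mx 1%:M 0 Y Z *m g.
  rewrite [RHS]mul_col_mx; congr col_mx.
  by rewrite /g mul_row_col mul1mx mul0mx addr0.
by rewrite /row_free mxrankMfree // row_free_unit.
Qed.

End Stable.
End Blocks.


(** * Stable subspaces *)

Section Embeddings.
Variable F : finFieldType.

Definition is_emb m n (D : 'M[F]_m) (A : 'M[F]_n) : pred 'M[F]_(m, n) :=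
  fun U => row_free U && (U *m A == D *m U).

Definition num_emb m n (D : 'M[F]_m) (A : 'M[F]_n) : nat :=
  (\sum_(U | is_emb D A U) 1)%N.

Lemma is_emb_col m k n (B : 'M[F]_m) C (D : 'M[F]_k) (A : 'M[F]_n) U V :
  is_emb (block_mx B 0 C D) A (col_mx U V) =
  [&& is_emb B A U, row_free (col_mx U V) & V *m A == C *m U + D *m V].
Proof.
rewrite /is_emb; case: (boolP (row_free (col_mx U V))) => [/row_free_colU ->|_] /=.
  rewrite mul_col_mx mul_block_col mul0mx addr0.
  by apply/eqP/andP => [/eq_col_mx[-> ->]|[/eqP-> /eqP->]].
by rewrite andbF.
Qed.

(** In the basis [col_mx U (compl U)] the relation for the new rows splits: the [compl] part says
    that [Z] embeds [D] in the quotient, the [U] part determines [C]. The witness [C0] is the lower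
    left block of [A] in that basis. *)
Lemma is_emb_col_quo m k n (B : 'M[F]_m) (D : 'M[F]_k) (A : 'M[F]_(m + n)) U :
  is_emb B A U -> exists C0, forall C (Y : 'M[F]_(k, m)) (Z : 'M[F]_(k, n)),
  is_emb (block_mx B 0 C D) A (col_mx U (row_mx Y Z *m col_mx U (compl U))) =
  (C == Y *m B + Z *m C0 - D *m Y) && is_emb D (quo U A) Z.
Proof.
move=> embU; have /andP[fU /eqP UA] := embU.
have [C0 gA] := stable_block fU UA; exists C0 => C Y Z.
have gu := compl_unit fU.
rewrite is_emb_col embU row_free_col_quo // /is_emb -mulmxA gA /=.
rewrite [RHS]andbCA; congr andb; set g := col_mx _ _ in gA gu *.
have -> : C *m U = row_mx C 0 *m g by rewrite /g mul_row_col mul0mx addr0.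
rewrite !mulmxA -mulmxDl -subr_eq0 -mulmxBl mulmx_free_eq0 ?row_free_unit //.
rewrite mul_row_block mul_mx_row add_row_mx opp_row_mx add_row_mx row_mx_eq0.
rewrite mulmx0 !add0r !subr_eq0; congr andb.
by rewrite [LHS]eq_sym [RHS]eq_sym subr_eq.
Qed.

(** Each embedding [Z] into the quotient and each of its [#|F| ^ (k * m)] lifts, indexed by [Y],
    belong to exactly one [C]. *)
Lemma num_emb_chain m k n (B : 'M[F]_m) (D : 'M[F]_k) (A : 'M[F]_(m + n)) :
  (\sum_(C : 'M[F]_(k, m)) num_emb (block_mx B 0 C D) A =
   \sum_(U | is_emb B A U) #|F| ^ (k * m) * num_emb D (quo U A))%N.
Proof.
under [LHS]eq_bigr => C _ do rewrite /num_emb big_col_mx.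
rewrite exchange_big [RHS]big_mkcond /=; apply: eq_bigr => U _.
case: ifP => [embU|nembU]; last first.
  rewrite big1 // => C _; rewrite big1 // => V.
  by rewrite is_emb_col nembU.
have /andP[fU _] := embU; have gu := compl_unit fU.
have [C0 eC] := is_emb_col_quo D embU.
under eq_bigr => C _.
  rewrite (big_mulmxr _ _ _ gu) big_row_mx /=.
  under eq_bigr => Y _ do under eq_bigl => Z do rewrite eC.
  over.
rewrite exchange_big /= -card_mx -sum_nat_const; apply: eq_bigr => Y _.
rewrite (exchange_big_dep (is_emb D (quo U A))) /=; last by move=> ? ? _ /andP[].
apply: eq_bigr => Z embZ; under eq_bigl => C do rewrite embZ andbT.
by rewrite big_pred1_eq.
Qed.

End Embeddings.

Lemma irr_coprimep (K : fieldType) (f g : {poly K}) :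
  irreducible_poly f -> coprimep f g = ~~ (f %| g).
Proof.
move=> [f_gt1 irrf]; apply/idP/idP => [cfg|nfg].
  apply: contraTN cfg => fg; rewrite /coprimep.
  have /eqp_size -> : gcdp f g %= f by rewrite dvdp_gcd_idl.
  by rewrite neq_ltn f_gt1 orbT.
apply: contraNT nfg; rewrite coprimep_def => /irrf/(_ (dvdp_gcdl f g)) e.
by rewrite -(eqp_dvdl _ e) dvdp_gcdr.
Qed.

(** * Homomorphisms from simple modules *)

Section Homs.
Variable F : finFieldType.

Definition num_hom d n (D : 'M[F]_d) (A : 'M[F]_n) : nat :=
  (\sum_(W : 'M[F]_(d, n) | W *m A == D *m W) 1)%N.

Lemma char_poly_dvd_emb a d (U : 'M[F]_(a, d)) (D : 'M[F]_d) (B : 'M[F]_a) :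
  row_free U -> U *m D = B *m U -> char_poly B %| char_poly D.
Proof.
move=> fU UD; have le_ad : (a <= d)%N by rewrite -(eqP fU) rank_leq_col.
move: U D fU UD; rewrite -(subnKC le_ad) => U D fU UD.
by rewrite (char_poly_quo fU UD) dvdp_mulr.
Qed.

(** A proper nonzero stable subspace would give the characteristic polynomial a proper divisor. *)
Lemma irr_stable_full l d (D : 'M[F]_d) (S : 'M[F]_(l, d)) :
  irreducible_poly (char_poly D) -> (S *m D <= S)%MS -> S != 0 -> row_full S.
Proof.
move=> [_ irrD] SD S0; set U := row_base S.
have /submxP[B UD] : (U *m D <= U)%MS.
  by rewrite (eqmxMr _ (eq_row_base S)) eq_row_base.
have fU : row_free U by apply: row_base_free.
have dvd := char_poly_dvd_emb fU UD.
have sz1 : size (char_poly B) != 1%N by rewrite size_char_poly eqSS mxrank_eq0.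
have := irrD _ sz1 dvd => /eqp_size; rewrite !size_char_poly => -[rk].
by rewrite /row_full rk.
Qed.

Lemma irr_size_gt0 d (D : 'M[F]_d) :
  irreducible_poly (char_poly D) -> (0 < d)%N.
Proof. by case; rewrite size_char_poly. Qed.

(** The vectors that [W] maps into the row space of [Z] form a submodule of the simple module of
    [D], hence zero or everything. *)
Lemma row_free_col_hom d k n (D : 'M[F]_d) (E : 'M[F]_k) (A : 'M[F]_n) W Z :
  irreducible_poly (char_poly D) -> W *m A = D *m W -> is_emb E A Z ->
  row_free (col_mx W Z) = ~~ (W <= Z)%MS.
Proof.
move=> irrD WA /andP[fZ /eqP ZA]; have d_gt0 := irr_size_gt0 irrD.
apply/row_free_kerP/idP => [inj|nWZ v].
  apply/negP => /submxP[Y WE]; pose x : 'rV[F]_d := delta_mx 0 (Ordinal d_gt0).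
  have /inj : row_mx x (- (x *m Y)) *m col_mx W Z = 0.
    by rewrite mul_row_col WE mulNmx mulmxA subrr.
  move/(congr1 (fun M : 'rV_(d + k) => M 0 (lshift k (Ordinal d_gt0)))).
  by rewrite row_mxEl !mxE !eqxx => /eqP; rewrite oner_eq0.
rewrite -[v]hsubmxK mul_row_col; set x := lsubmx v; set y := rsubmx v => xy.
have x0 : x = 0.
  apply/eqP; apply: contraNT nWZ => nx0.
  have inS (z : 'rV_d) : (z <= kermx (W *m cokermx Z))%MS = (z *m W <= Z)%MS.
    by rewrite sub_kermx mulmxA -submxE.
  have xS : (x <= kermx (W *m cokermx Z))%MS.
    by rewrite inS (canRL (addrK _) xy) sub0r -mulNmx submxMl.
  have : row_full (kermx (W *m cokermx Z)).
    apply: (irr_stable_full irrD).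
      apply/row_subP => i; rewrite row_mul inS -mulmxA -WA mulmxA.
      have : (row i (kermx (W *m cokermx Z)) *m W <= Z)%MS by rewrite -inS row_sub.
      by move/submxP => [t ->]; rewrite -mulmxA ZA mulmxA submxMl.
    by apply: contraNneq nx0 => S0; move: xS; rewrite S0 submx0.
  rewrite -sub1mx sub_kermx mul1mx => /eqP WC.
  by rewrite submxE WC.
move: xy; rewrite x0 mul0mx add0r => /eqP; rewrite mulmx_free_eq0 // => /eqP ->.
by rewrite row_mx0.
Qed.

(** Once [Z] is chosen, [W] may be any homomorphism whose image is not inside that of [Z]; the
    excluded ones factor through [Z] and are the homomorphisms from [D] to [E]. The additive form
    avoids subtraction in [nat]. *)
Lemma num_emb_step d k n (D : 'M[F]_d) (E : 'M[F]_k) (A : 'M[F]_n) :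
  irreducible_poly (char_poly D) ->
  (num_emb (block_mx D 0 0 E) A + num_emb E A * num_hom D E =
   num_emb E A * num_hom D A)%N.
Proof.
move=> irrD; rewrite /num_emb big_col_mx (exchange_big_dep xpredT) /=; last by [].

rewrite [X in (X * _)%N]big_mkcond [X in _ = (X * _)%N]big_mkcond /=.
rewrite !big_distrl -big_split /=; apply: eq_bigr => Z _.
case: ifP => embZ; last first.
  rewrite !mul0n addn0 big1 // => W; rewrite /is_emb; case: (boolP (row_free _)) => //=.
  move=> fWZ; rewrite mul_col_mx mul_block_col !mul0mx addr0 add0r.
  move=> /eqP/eq_col_mx[_ /eqP ZA]; move: embZ.
  by rewrite /is_emb ZA (row_free_colD fWZ).
rewrite !mul1n; have /andP[fZ /eqP ZA] := embZ.
rewrite /num_hom [RHS](bigID (fun W => (W <= Z)%MS)) /= addnC; congr addn.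
  rewrite (reindex_onto (fun Y => Y *m Z) (fun W => W *m pinvmx Z)) /=; last first.
    by move=> W /andP[_ WZ]; rewrite mulmxKpV.
  apply: eq_bigl => Y; rewrite mulmxKp // eqxx submxMl !andbT.
  by rewrite -mulmxA ZA !mulmxA -[RHS]subr_eq0 -mulmxBl mulmx_free_eq0 // subr_eq0.
apply: eq_bigl => W; rewrite /is_emb mul_col_mx mul_block_col !mul0mx addr0 add0r ZA.
case: eqP => [/eq_col_mx[WA _]|nWA].
  by rewrite (row_free_col_hom irrD WA embZ) WA eqxx andbT.
by rewrite andbF; case: eqP => // WA; case: nWA; rewrite WA.
Qed.

Lemma num_hom_block d k l (D : 'M[F]_d) (E1 : 'M[F]_k) (E2 : 'M[F]_l) :
  num_hom D (block_mx E1 0 0 E2) = (num_hom D E1 * num_hom D E2)%N.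
Proof.
rewrite /num_hom big_row_mx big_distrl [RHS]big_mkcond /=.
apply: eq_bigr => W1 _; case: ifP => h1; last first.
  rewrite big1 // => W2; rewrite mul_row_block mul_mx_row !mulmx0 addr0 add0r.
  by move=> /eqP/eq_row_mx[/eqP]; rewrite h1.
rewrite mul1n; apply: eq_bigl => W2.
rewrite mul_row_block mul_mx_row !mulmx0 addr0 add0r (eqP h1).
by apply/eqP/eqP => [/eq_row_mx[]|->].
Qed.

(** [char_poly D] vanishes at [D] but is invertible at [A], so every intertwiner is zero. *)
Lemma num_hom_coprime d n (D : 'M[F]_d) (A : 'M[F]_n) :
  coprimep (char_poly D) (char_poly A) -> num_hom D A = 1%N.
Proof.
rewrite -coprimep_char => fA; rewrite /num_hom (big_pred1 0) // => W /=.
apply/eqP/eqP => [WA|->]; last by rewrite mul0mx mulmx0.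
have /eqP := peval_inter (char_poly D) WA; rewrite peval_char mul0mx.
by rewrite mulmx_free_eq0 ?row_free_unit // => /eqP.
Qed.

Lemma num_hom0 d (D : 'M[F]_d) (A : 'M[F]_0) : num_hom D A = 1%N.
Proof.
rewrite /num_hom (big_pred1 0) // => W /=.
by rewrite [W]thinmx0 mul0mx mulmx0 !eqxx.
Qed.

(** A nonzero [v] with [v f(A) = 0] gives the nonzero homomorphism with rows [v A^i], besides the
    zero one. *)
Lemma num_hom_gt1 n (f : {poly F}) (A : 'M[F]_n) :
  f \is monic -> (1 < size f)%N -> ~~ coprimep f (char_poly A) ->
  (1 < num_hom (companionmx f) A)%N.
Proof.
move=> f_monic f_gt1; rewrite -coprimep_char -row_free_unit -kermx_eq0.
move=> /rowV0Pn[v /sub_kermxP vfA v0].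
pose W := \matrix_(i < (size f).-1) (v *m peval A 'X^i).
have d_gt0 : (0 < (size f).-1)%N by case: (size f) f_gt1 => [|[]].
have WA : W *m A = companionmx f *m W.
  apply/row_matrixP => i; rewrite !row_mul rowK -mulmxA -{2}[A]pevalX -pevalM -exprSr.
  rewrite [RHS]mulmx_sum_row.
  case: (ltnP i.+1 (size f).-1) => [lt_i|ge_i].
    rewrite (bigD1 (Ordinal lt_i)) //= big1 ?addr0 => [|j nj].
      rewrite !mxE rowK /= eqxx ifN ?scale1r //.
      by rewrite neq_ltn -ltnS prednK // lt_i.
    rewrite !mxE ifN; last by rewrite neq_ltn -ltnS prednK // lt_i.
    by rewrite -val_eqE /= eq_sym in nj; rewrite (negPf nj) scale0r.
  have ei : i.+1 = (size f).-1 by apply/eqP; rewrite eqn_leq ge_i ltn_ord.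
  (* As [f] is monic, the top power of ['X] is [f] minus the lower terms, and [f(A)] kills [v]; this
     matches the last row of the companion matrix. *)
  have -> : 'X^(i.+1) = f - \sum_(j < (size f).-1) f`_j *: 'X^j.
    rewrite -[X in X - _]coefK poly_def.
    have recr e : size f = e.+1 ->
        \sum_(j < size f) f`_j *: 'X^j = \sum_(j < e) f`_j *: 'X^j + f`_e *: 'X^e.
      by move=> ->; rewrite big_ord_recr.
    rewrite (recr (size f).-1) ?prednK 1?ltnW //.
    by rewrite addrC addKr -lead_coefE (monicP f_monic) scale1r ei.
  rewrite pevalD pevalN mulmxBr vfA sub0r.
  have -> : peval A (\sum_(j < (size f).-1) f`_j *: 'X^j) =
            \sum_(j < (size f).-1) f`_j *: peval A 'X^j.
    elim/big_ind2: _ => [|p1 ? p2 ? <- <-|j _].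
    - by rewrite peval0.
    - by rewrite pevalD.
    by rewrite -mul_polyC pevalM pevalC mul_scalar_mx.
  rewrite mulmx_sumr -sumrN; apply: eq_bigr => j _.
  have ed : (i == (size f).-1.-1 :> nat) by rewrite -(congr1 predn ei).
  by rewrite !mxE rowK ed -scalemxAr scaleNr.
rewrite /num_hom (bigD1 W) ?WA //= (bigD1 0) ?mul0mx ?mulmx0 ?eqxx //=.
apply: contraNneq v0 => W0; have := rowK (fun i : 'I_(size f).-1 => v *m peval A 'X^i) (Ordinal d_gt0).
by rewrite -/W -W0 row0 expr0 -polyC1 pevalC mulmx1 => <-.
Qed.

Lemma num_hom_self d (D : 'M[F]_d) : irreducible_poly (char_poly D) ->
  num_hom D D = (#|F| ^ d)%N.
Proof.
move=> irrD; have d_gt0 := irr_size_gt0 irrD.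
rewrite /num_hom sum1dep_card; apply/eqP; rewrite eqn_leq; apply/andP; split.
  (* Upper bound: a homomorphism is determined by the image of one nonzero vector, because the
     kernel of a difference is a submodule. *)
  rewrite -[d in X in (_ <= X)%N]mul1n -card_mx.
  pose e : 'rV[F]_d := delta_mx 0 (Ordinal d_gt0).
  rewrite -(card_in_imset (f := fun W : 'M[F]_d => e *m W)) ?max_card // => V W.
  rewrite !inE => /eqP VD /eqP WD eVW; apply/eqP; rewrite -subr_eq0.
  set X := V - W; have XD : X *m D = D *m X by rewrite mulmxBl mulmxBr VD WD.
  have eX : e *m X = 0 by rewrite mulmxBr eVW subrr.
  have : row_full (kermx X).
    apply: (irr_stable_full irrD).
      by apply/sub_kermxP; rewrite -mulmxA -XD mulmxA mulmx_ker mul0mx.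
    apply/eqP => K0; have : (e <= kermx X)%MS by apply/sub_kermxP.
    rewrite K0 submx0 => /eqP/(congr1 (fun M : 'rV_d => M 0 (Ordinal d_gt0))).
    by rewrite !mxE !eqxx => /eqP; rewrite oner_eq0.
  by rewrite -sub1mx => /sub_kermxP; rewrite mul1mx => ->.
(* Lower bound: polynomials of size at most [d] give distinct endomorphisms, since a nonzero
   difference is coprime to [char_poly D] and hence invertible at [D]. *)
rewrite -[d in X in (X <= _)%N]mul1n -card_mx.
rewrite -(card_in_imset (f := fun v : 'rV_d => peval D (rVpoly v))).
  apply/subset_leq_card/fintype.subsetP => _ /imsetP[v _ ->]; rewrite inE.
  by rewrite -(peval_inter (A := D) (B := D)).
move=> u v _ _ euv; apply/eqP; rewrite -subr_eq0 -[u - v]rVpolyK raddfB /=.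
set q := _ - _; have [->|q0] := eqVneq q 0; first by rewrite raddf0.
have Dq : peval D q = 0 by rewrite pevalD pevalN euv subrr.
have : coprimep q (char_poly D).
  rewrite coprimep_sym irr_coprimep //; apply: contraL (isT) => /(dvdp_leq q0).
  rewrite size_char_poly /q -raddfB => /leq_trans/(_ (size_poly _ _)).
  by rewrite ltnn.
by rewrite -coprimep_char Dq -row_free_unit /row_free mxrank0 ltn_eqF.
Qed.

End Homs.

(** * Counting bases and primary components *)

Section Counts.
Variable F : finFieldType.

Definition gl_order n : nat := (\sum_(g : 'M[F]_n | g \in unitmx) 1)%N.

Lemma gl_order_gt0 n : (0 < gl_order n)%N.
Proof. by rewrite /gl_order (bigD1 1%:M) ?unitmx1. Qed.

(** In the basis completed by [compl Z], the remaining rows of an invertible matrix have an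
    arbitrary part along [Z] and an invertible part in the quotient. *)
Lemma sum_row_free k m :
  ((\sum_(Z : 'M[F]_(k, k + m) | row_free Z) 1) * (gl_order m * #|F| ^ (m * k)) =
   gl_order (k + m))%N.
Proof.
rewrite big_distrl /= [RHS]/gl_order big_col_mx big_mkcond /=; apply: eq_bigr => Z _.
case: ifP => [fZ|nfZ]; last first.
  by rewrite big1 // => W; rewrite -row_free_unit => /row_free_colU; rewrite nfZ.
rewrite mul1n (big_mulmxr _ _ _ (compl_unit fZ)) big_row_mx /= mulnC -card_mx.
rewrite -sum_nat_const; apply: eq_bigr => Y _; apply: eq_bigl => Y'.
by rewrite -!row_free_unit row_free_col_quo.
Qed.

(** A change of basis moves [Z] to [row_mx 1%:M 0] and leaves the matrices [block_mx D 0 C X] with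
    [C] free, so every [Z] contributes equally. The factors [gl_order] come from [sum_row_free]. *)
Lemma sum_num_emb_char k m (D : 'M[F]_k) (G : {poly F}) :
  ((\sum_(B : 'M[F]_(k + m) | char_poly B == G) num_emb D B) * gl_order m =
   gl_order (k + m) * (\sum_(B' : 'M[F]_m | (char_poly D * char_poly B')%R == G) 1))%N.
Proof.
rewrite -sum_row_free; set S := (\sum_(B' : 'M[F]_m | _) _)%N.
suff -> : (\sum_(B : 'M[F]_(k + m) | char_poly B == G) num_emb D B =
    (\sum_(Z : 'M[F]_(k, k + m) | row_free Z) 1) * (#|F| ^ (m * k) * S))%N.
  by rewrite -!mulnA [(gl_order m * _)%N]mulnC -!mulnA.
rewrite /num_emb (exchange_big_dep (fun Z => row_free Z)) /=; last first.
  by move=> ? ? _ /andP[].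
rewrite big_distrl /=; apply: eq_bigr => Z fZ; rewrite mul1n.
have gu := compl_unit fZ; set g := col_mx _ _ in gu.
rewrite (big_conj _ _ _ gu) big_col_mx /= big_row_mx /=.
have Zg : Z *m invmx g = row_mx 1%:M 0.
  have -> : Z = row_mx 1%:M 0 *m g by rewrite mul_row_col mul1mx mul0mx addr0.
  by rewrite mulmxK.
rewrite (bigD1 D) //= [X in (_ + X)%N]big1 ?addn0; last first.
  move=> D' nD; rewrite big1 // => Y _; rewrite big1 // => X /andP[_ /andP[_]].
  rewrite !mulmxA Zg mul_row_col mul1mx mul0mx addr0.
  have -> : D *m Z = row_mx D 0 *m g by rewrite mul_row_col mul0mx addr0.
  by rewrite -subr_eq0 -mulmxBl mulmx_free_eq0 ?row_free_unit // subr_eq0 =>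
    /eqP/eq_row_mx[] /eqP; rewrite (negPf nD).
rewrite (bigD1 0) //= [X in (_ + X)%N]big1 ?addn0; last first.
  move=> Y nY; rewrite big1 // => X /andP[_ /andP[_]].
  rewrite !mulmxA Zg mul_row_col mul1mx mul0mx addr0.
  have -> : D *m Z = row_mx D 0 *m g by rewrite mul_row_col mul0mx addr0.
  by rewrite -subr_eq0 -mulmxBl mulmx_free_eq0 ?row_free_unit // subr_eq0 =>
    /eqP/eq_row_mx[_] /eqP; rewrite (negPf nY).
rewrite big_row_mx /= -card_mx -sum_nat_const; apply: eq_bigr => C _.
apply: eq_bigl => X; rewrite -/(block_mx D 0 C X).
rewrite (char_poly_conj (g := g) (B := block_mx D 0 C X)) //; last first.
  by rewrite !mulmxA mulmxV // mul1mx.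
rewrite char_poly_lblock /is_emb fZ !mulmxA Zg mul_row_block !mul1mx !mul0mx.
by rewrite !addr0 mul_row_col mul0mx addr0 eqxx !andbT.
Qed.

Lemma emb_rank m n (D : 'M[F]_m) (A : 'M[F]_n) : (n < m)%N -> num_emb D A = 0%N.
Proof.
move=> lt_nm; rewrite /num_emb big1 // => U /andP[/eqP rU _].
by have := rank_leq_col U; rewrite rU leqNgt lt_nm.
Qed.

(** [G] vanishes at [B], so [char_poly B] is coprime to [H]; [G] is invertible on the quotient,
    whose polynomial is therefore coprime to [G]. Gauss's lemma applied to the two factorizations of
    [char_poly A] gives divisibility both ways. *)
Lemma char_poly_ker r n (U : 'M[F]_(r, r + n)) A B G H :
  row_free U -> (U :=: kermx (peval A G))%MS -> U *m A = B *m U ->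
  char_poly A = G * H -> G \is monic -> coprimep G H -> char_poly B = G.
Proof.
move=> fU UK UA cpA Gm cGH; have [[u v] /= uv] := Bezout_eq1_coprimepP _ _ cGH.
have BG : peval B G = 0.
  apply/eqP; rewrite -(mulmx_free_eq0 _ fU) -(peval_inter G UA); apply/eqP.
  by apply/sub_kermxP; rewrite UK.
have cHB : coprimep H (char_poly B).
  rewrite -coprimep_char; have /(congr1 (peval B)) := uv.
  rewrite pevalD !pevalM BG mulmx0 add0r -polyC1 pevalC.
  by case/mulmx1_unit.
have [C gA] := stable_block fU UA; have gu := compl_unit fU.
set g := col_mx _ _ in gA gu; set A' := quo U A in gA; set M := block_mx _ _ _ _ in gA.
(* If [G] kills [z] in the quotient, a lift [w] satisfies [w G(A)^2 = 0] and [w G(A) H(A) = 0];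
   hence [w G(A) = 0] by Bezout and [w] lies in [U]. *)
have cGA' : coprimep G (char_poly A').
  rewrite -coprimep_char -row_free_unit; apply/row_free_kerP => z zG.
  pose w : 'rV_(r + n) := row_mx 0 z *m g.
  have [y wG] : exists y, w *m peval A G = y *m U.
    exists (lsubmx (row_mx 0 z *m peval M G)).
    rewrite /w -mulmxA (peval_inter G gA) mulmxA.
    have Mc : M *m col_mx 0 1%:M = col_mx 0 1%:M *m A' :> 'M[F]_(r + n, n).
      by rewrite mul_block_col mul_col_mx !mulmx0 mul0mx !add0r !(mulmx1, mul1mx).
    have : row_mx 0 z *m peval M G *m col_mx 0 1%:M = 0.
      by rewrite -mulmxA -(peval_inter G (esym Mc)) mulmxA mul_row_col mul0mx add0r mulmx1 zG.
    set x := row_mx 0 z *m peval M G; rewrite -{1}[x]hsubmxK mul_row_col mulmx0 add0r mulmx1 => eq0.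
    by rewrite -{1}[x]hsubmxK eq0 mul_row_col mul0mx addr0.
  have wG0 : w *m peval A G = 0.
    rewrite -[LHS]mulmx1 -(pevalC A 1) polyC1 -uv pevalD [v * H]mulrC !pevalM.
    rewrite mulmxDr !mulmxA; have yG : w *m peval A G *m peval A G = 0.
      by rewrite wG -mulmxA (_ : U *m _ = 0) ?mulmx0 //; apply/sub_kermxP; rewrite UK.
    rewrite -[w *m _ *m peval A u *m _]mulmxA -pevalM mulrC pevalM mulmxA yG mul0mx add0r.
    by rewrite -[w *m _ *m _]mulmxA -pevalM -cpA peval_char mulmx0 mul0mx.
  have /submxP[t wt] : (w <= U)%MS by rewrite UK; apply/sub_kermxP.
  have : row_mx 0 z *m g = row_mx t 0 *m g.
    by rewrite -/w wt mul_row_col mul0mx addr0.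
  have gf : row_free g by rewrite row_free_unit.
  by move/(row_free_inj gf)/eq_row_mx => [].
have cpA' : G * H = char_poly B * char_poly A' by rewrite -cpA (char_poly_quo fU UA).
apply/eqP; rewrite -eqp_monic ?char_poly_monic //; apply/andP; split.
  by rewrite -(Gauss_dvdpl _ (q := H)) 1?coprimep_sym // cpA' dvdp_mulr.
by rewrite -(Gauss_dvdpl _ (q := char_poly A')) // -cpA' dvdp_mulr.
Qed.

(* The only stable subspace with characteristic polynomial G is the kernel of G(A);
   its bases are permuted simply transitively by the linear group. *)
Lemma num_emb_primary m n (A : 'M[F]_n) (G H : {poly F}) :
  size G = m.+1 -> G \is monic -> char_poly A = G * H -> coprimep G H ->
  (\sum_(B : 'M[F]_m | char_poly B == G) num_emb B A = gl_order m)%N.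
Proof.
move=> sG Gm cpA cGH; set K := kermx (peval A G); set U0 := row_base K.
have fU0 : row_free U0 by apply: row_base_free.
have U0K : (U0 :=: K)%MS by apply: eq_row_base.
have /submxP[B0 UB0] : (U0 *m A <= U0)%MS.
  rewrite (eqmxMr _ U0K) U0K; apply/sub_kermxP; rewrite -mulmxA.
  by rewrite (peval_inter (A := A) (B := A)) // mulmxA mulmx_ker mul0mx.
have cpB0 : char_poly B0 = G.
  have le_rn : (\rank K <= n)%N by apply: rank_leq_col.
  move: (U0) (B0) fU0 U0K UB0; rewrite /K; move: (\rank K) le_rn => r le_rn.
  clear -cpA cGH Gm le_rn; move: A cpA; rewrite -(subnKC le_rn) => A cpA U B fU UK UB.
  exact: char_poly_ker fU UK UB cpA Gm cGH.
have rKm : \rank K = m by apply: succn_inj; rewrite -sG -cpB0 size_char_poly.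
move: U0 B0 fU0 U0K UB0 cpB0; rewrite rKm => U0 B0 fU0 U0K UB0 cpB0.
rewrite /num_emb (exchange_big_dep xpredT) //= /gl_order.
rewrite (bigID (fun U => (U *m pinvmx U0 *m U0 == U) && (U *m pinvmx U0 \in unitmx))) /=.
rewrite [X in (_ + X)%N]big1 ?addn0; last first.
  move=> U nU; rewrite big1 // => B /andP[/eqP cpB /andP[fU /eqP UB]].
  have UU0 : (U <= U0)%MS.
    rewrite U0K; apply/sub_kermxP.
    by rewrite (peval_inter _ UB) -cpB peval_char mul0mx.
  move: nU; rewrite mulmxKpV // eqxx /= -row_free_unit => /negP[].
  by rewrite -row_leq_rank -{1}(eqP fU) -{1}(mulmxKpV UU0) mxrankM_maxl.
rewrite (reindex_onto (fun g => g *m U0) (fun U => U *m pinvmx U0)) /=; last first.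
  by move=> U /andP[/eqP].
apply: eq_big => g; first by rewrite mulmxKp // !eqxx andbT.
rewrite mulmxKp // !eqxx /= andbT => gu.
rewrite (big_pred1 (g *m B0 *m invmx g)) // => B /=.
have -> : is_emb B A (g *m U0) = (B == g *m B0 *m invmx g).
  have fgU : row_free (g *m U0).
    by move: gu; rewrite -row_free_unit /row_free mxrankMfree.
  rewrite /is_emb fgU -mulmxA UB0 /= !mulmxA -subr_eq0 -mulmxBl mulmx_free_eq0 //.
  rewrite subr_eq0; apply/eqP/eqP => [->|->]; first by rewrite mulmxK.
  by rewrite mulmxKV.
case: (B =P _) => [->|_]; rewrite ?andbF ?andbT //.
by rewrite -cpB0 (@char_poly_conj _ _ g B0 (g *m B0 *m invmx g)) ?eqxx // mulmxKV.
Qed.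

End Counts.


(** * Identities in q *)

Section QIdentities.
Variables (R : realFieldType) (q : R).
Hypothesis q_gt1 : 1 < q.

Definition qfact k : R := \prod_(a < k) (q ^+ a.+1 - 1).
(** The Mobius value [(-1)^k q^(k choose 2)] of a [k]-dimensional space over a field with [q]
    elements, divided by the order of its linear group. *)
Definition alpha k : R := (-1) ^+ k / qfact k.
(* The sum of 1 / |Aut M| over the modules M of length k over a discrete valuation
   ring with residue field of size q. *)
Definition gam k : R := q ^+ 'C(k, 2) / qfact k.
(** At [X = q ^+ r], the number of injective linear maps from dimension [k] to dimension [r]. *)
Definition fall (X : R) k : R := \prod_(a < k) (X - q ^+ a).

Let q_gt0 : 0 < q. Proof. exact: lt_trans q_gt1. Qed.

Lemma expq_gt1 a : 1 < q ^+ a.+1.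
Proof. by rewrite exprn_egt1. Qed.

Lemma qfact_gt0 k : 0 < qfact k.
Proof. by apply: prodr_gt0 => a _; rewrite subr_gt0 expq_gt1. Qed.

Lemma qfact_neq0 k : qfact k != 0.
Proof. by rewrite gt_eqF // qfact_gt0. Qed.

Lemma qfactS k : qfact k.+1 = qfact k * (q ^+ k.+1 - 1).
Proof. by rewrite /qfact big_ord_recr. Qed.

Lemma fallS X k : fall X k.+1 = (X - 1) * \prod_(a < k) (X - q ^+ a.+1).
Proof. by rewrite /fall big_ord_recl. Qed.

Lemma alpha0 : alpha 0 = 1.
Proof. by rewrite /alpha /qfact big_ord0 expr0 divr1. Qed.

Lemma gam0 : gam 0 = 1.
Proof. by rewrite /gam /qfact big_ord0 expr0 divr1. Qed.

(* The left-hand side is the partial sum of the Mobius inversion formula for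
   the lattice of subspaces of a space with X elements over a field with q
   elements; it interpolates the indicator function of X = 1 at the powers of q. *)
Lemma sum_alpha_fall X K :
  \sum_(k < K.+1) alpha k * fall X k = (\prod_(a < K) (q ^+ a.+1 - X)) / qfact K.
Proof.
elim: K => [|K IHK].
  by rewrite big_ord_recl !big_ord0 addr0 alpha0 /fall /qfact !big_ord0 divr1 mulr1.
rewrite big_ord_recr IHK /= big_ord_recr /= fallS /alpha qfactS.
have -> : \prod_(a < K) (X - q ^+ a.+1) = (-1) ^+ K * \prod_(a < K) (q ^+ a.+1 - X).
  by under eq_bigr => a _ do rewrite -opprB; rewrite prodrN card_ord.
have := signrMK K (1 : R); rewrite mulr1 => sK.
have f0 := qfact_neq0 K; have g0 : q ^+ K.+1 - 1 != 0 by rewrite gt_eqF // subr_gt0 expq_gt1.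
set p := \prod_(a < K) _; rewrite exprS.
have -> : -1 * (-1) ^+ K / (qfact K * (q ^+ K.+1 - 1)) * ((X - 1) * ((-1) ^+ K * p))
  = - ((-1) ^+ K * (-1) ^+ K) / (qfact K * (q ^+ K.+1 - 1)) * ((X - 1) * p) by ring.
by rewrite sK; field; rewrite f0 g0.
Qed.

Lemma sum_alpha_fall_eq0 r K : (0 < r <= K)%N ->
  \sum_(k < K.+1) alpha k * fall (q ^+ r) k = 0.
Proof.
case: r => // r /= rK; rewrite sum_alpha_fall (bigD1 (Ordinal rK)) //=.
by rewrite subrr !mul0r.
Qed.

Lemma sum_alpha_fall1 K : \sum_(k < K.+1) alpha k * fall 1 k = 1.
Proof. by rewrite sum_alpha_fall divff ?qfact_neq0. Qed.

Lemma fall_ge0 r k : 0 <= fall (q ^+ r) k.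
Proof.
have [kr|rk] := leqP k r.
  apply: prodr_ge0 => a _; rewrite subr_ge0 ler_eXn2l //.
  exact: leq_trans (ltnW (ltn_ord a)) kr.
by rewrite /fall (bigD1 (Ordinal rk)) //= subrr mul0r.
Qed.

Lemma alpha_norm k : `|alpha k| = (qfact k)^-1.
Proof. by rewrite normrM normrX normrN1 expr1n mul1r gtr0_norm // invr_gt0 qfact_gt0. Qed.

(** The sum is exact for [r <= K]. Beyond that, the right-hand side is
    [(q^r - 1) / (q^(K+1) - 1) >= 1] times the left-hand side. *)
Lemma sum_alpha_fall_err r K :
  `|\sum_(k < K.+1) alpha k * fall (q ^+ r) k - (r == 0%N)%:R|
  <= (qfact K.+1)^-1 * fall (q ^+ r) K.+1.
Proof.
have rhs_ge0 : 0 <= (qfact K.+1)^-1 * fall (q ^+ r) K.+1.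
  by rewrite mulr_ge0 ?fall_ge0 // invr_ge0 ltW ?qfact_gt0.
case: r rhs_ge0 => [|r] rhs_ge0; first by rewrite expr0 sum_alpha_fall1 subrr normr0 -(expr0 q).
rewrite subr0; have [rK|Kr] := leqP r.+1 K; first by rewrite sum_alpha_fall_eq0 ?normr0.
rewrite sum_alpha_fall fallS qfactS normrM normfV (gtr0_norm (qfact_gt0 K)).
have -> : `|\prod_(a < K) (q ^+ a.+1 - q ^+ r.+1)| = \prod_(a < K) (q ^+ r.+1 - q ^+ a.+1).
  rewrite normr_prod; apply: eq_bigr => a _.
  rewrite distrC ger0_norm // subr_ge0 ler_eXn2l //.
  exact: leq_trans (ltn_ord a) (ltnW Kr).
set p := \prod_(a < K) _; have p0 : 0 <= p.
  apply: prodr_ge0 => a _; rewrite subr_ge0 ler_eXn2l //.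
  exact: leq_trans (ltn_ord a) (ltnW Kr).
have g0 : 0 < q ^+ K.+1 - 1 by rewrite subr_gt0 expq_gt1.
have -> : (qfact K * (q ^+ K.+1 - 1))^-1 * ((q ^+ r.+1 - 1) * p) =
          (q ^+ r.+1 - 1) / (q ^+ K.+1 - 1) * (p / qfact K).
  by field; rewrite qfact_neq0 gt_eqF.
rewrite ler_peMl ?divr_ge0 ?(ltW (qfact_gt0 K)) // ler_pdivlMr // mul1r.
by rewrite lerB // ler_eXn2l.
Qed.

Lemma fall_expq j k : (k <= j)%N ->
  fall (q ^+ j) k = q ^+ 'C(k, 2) * qfact j / qfact (j - k).
Proof.
elim: k => [|k IHk] le_kj; first by rewrite /fall big_ord0 subn0 mul1r divff ?qfact_neq0.
rewrite /fall big_ord_recr /= -/(fall _ k) IHk ?(ltnW le_kj) //.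
have -> : (j - k = (j - k.+1).+1)%N by rewrite subnSK.
rewrite qfactS binS bin1 exprD; set m := (j - k.+1)%N.
have -> : q ^+ j = q ^+ k * q ^+ m.+1 by rewrite -exprD addnS -addSn subnKC.
field.
by rewrite qfact_neq0 gt_eqF // subr_gt0 expq_gt1.
Qed.

(** The generating series of [alpha] and [gam] are inverse to each other: this is
    [sum_alpha_fall_eq0] at [r = K = j], with the order of summation reversed and [fall] rewritten
    by [fall_expq]. *)
Lemma alpha_gam_conv j : (0 < j)%N -> \sum_(k < j.+1) alpha k * gam (j - k) = 0.
Proof.
move=> j_gt0; have := sum_alpha_fall_eq0 (r := j) (K := j).
rewrite j_gt0 leqnn => /(_ isT) eq0.
suff -> : \sum_(k < j.+1) alpha k * gam (j - k) =
    (-1) ^+ j / qfact j * \sum_(k < j.+1) alpha k * fall (q ^+ j) k.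
  by rewrite eq0 mulr0.
rewrite (reindex_inj rev_ord_inj) big_distrr /=; apply: eq_bigr => k _.
have le_kj : (k <= j)%N by rewrite -ltnS.
rewrite subSS subKn // fall_expq // /alpha /gam.
have -> : (-1) ^+ (j - k) = (-1) ^+ j * (-1) ^+ k :> R.
  by rewrite -signr_odd oddB // signr_addb !signr_odd.
by field; rewrite !qfact_neq0.
Qed.

Lemma conv_gam (c : nat -> R) : (forall a, (0 < a)%N ->
    \sum_(k < a.+1) alpha k * c (a - k)%N = 0) ->
  forall a, c a = gam a * c 0%N.
Proof.
move=> rec a; have [n le_an] := ubnP a; elim: n a le_an => // n IHn [|a] le_an.
  by rewrite gam0 mul1r.
have := rec a.+1 isT; have := alpha_gam_conv (j := a.+1) isT.
rewrite ![\sum_(k < a.+2) _]big_ord_recl /= !alpha0 !mul1r !subn0 => /(canRL (addrK _)) ->.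
move/(canRL (addrK _)) => ->; rewrite !sub0r mulNr big_distrl /=; congr (- _).
apply: eq_bigr => k _; rewrite IHn ?mulrA //.
by rewrite /bump /= add1n subSS (leq_ltn_trans (leq_subr _ _)).
Qed.

End QIdentities.


(** * Counting matrices by characteristic polynomial *)

Section Companion.
Variable F : finFieldType.

Fixpoint cdim (s : seq {poly F}) : nat :=
  if s is f :: s' then ((size f).-1 + cdim s')%N else 0%N.

Fixpoint cmx (s : seq {poly F}) : 'M[F]_(cdim s) :=
  if s is f :: s' then block_mx (companionmx f) 0 0 (cmx s') else 0.

Definition residue_card (f : {poly F}) : nat := (#|F| ^ (size f).-1)%N.

Definition monic_irr (f : {poly F}) := f \is monic /\ irreducible_poly f.

Lemma companion_irr f : monic_irr f -> irreducible_poly (char_poly (companionmx f)).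
Proof. by case=> fm firr; rewrite companionmxK. Qed.

Lemma monic_irr_coprime f g : monic_irr f -> monic_irr g -> f != g -> coprimep f g.
Proof.
move=> [fm firr] [gm girr] nfg; rewrite irr_coprimep //.
apply: contraNN nfg => fg; rewrite -eqp_monic //; apply: girr.2 => //.
by rewrite neq_ltn; case: firr => ->; rewrite orbT.
Qed.

Lemma char_poly_cmx s : (forall f, f \in s -> f \is monic) ->
  char_poly (cmx s) = \prod_(f <- s) f.
Proof.
elim: s => [|f s IHs] sm /=; first by rewrite big_nil /char_poly det_mx00.
rewrite big_cons char_poly_lblock companionmxK ?sm ?mem_head // IHs // => g gs.
by rewrite sm // inE gs orbT.
Qed.

Lemma num_hom_cmx f s : monic_irr f -> (forall g, g \in s -> monic_irr g) ->
  num_hom (companionmx f) (cmx s) = (residue_card f ^ count_mem f s)%N.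
Proof.
move=> f_mi; elim: s => [|g s IHs] smi /=; first by rewrite num_hom0.
rewrite num_hom_block IHs => [|h hs]; last by apply: smi; rewrite inE hs orbT.
rewrite expnD; congr muln; have g_mi := smi g (mem_head _ _).
case: eqP => [->|/eqP ngf]; first by rewrite num_hom_self ?expn1 //; apply: companion_irr.
rewrite num_hom_coprime // !companionmxK ?(proj1 f_mi) ?(proj1 g_mi) //.
by apply: monic_irr_coprime; rewrite // eq_sym.
Qed.

Lemma num_emb_nil n (A : 'M[F]_n) : num_emb (cmx [::]) A = 1%N.
Proof.
rewrite /num_emb (big_pred1 0) // => U /=.
rewrite [U]flatmx0 eqxx /is_emb mul0mx mulmx0 eqxx andbT.
by rewrite /row_free mxrank0.
Qed.

Section Real.
Variable R : realFieldType.

Lemma num_emb_cons n (A : 'M[F]_n) f s : monic_irr f -> (forall g, g \in s -> monic_irr g) ->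
  (num_emb (cmx (f :: s)) A)%:R = (num_emb (cmx s) A)%:R *
   ((num_hom (companionmx f) A)%:R - (residue_card f)%:R ^+ count_mem f s) :> R.
Proof.
move=> f_mi smi; have := num_emb_step (cmx s) A (companion_irr f_mi).
rewrite num_hom_cmx // => /(congr1 (fun k => k%:R : R)).
rewrite natrD !natrM natrX => eq0; rewrite mulrBr -eq0.
by rewrite addrK.
Qed.

(** With [a] copies of [f] already placed, the next one must avoid the [q^a] homomorphisms into
    them, where [q] is the residue cardinal; [s] contains no further copy. *)
Lemma num_emb_nseq n (A : 'M[F]_n) f s k : monic_irr f -> (forall g, g \in s -> monic_irr g) ->
  f \notin s ->
  (num_emb (cmx (nseq k f ++ s)) A)%:R = (num_emb (cmx s) A)%:R *
    fall (residue_card f)%:R (num_hom (companionmx f) A)%:R k :> R.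
Proof.
move=> f_mi smi fs; elim: k => [|k IHk]; first by rewrite /fall big_ord0 mulr1.
rewrite [nseq _ _ ++ _]/= num_emb_cons // => [|g]; last first.
  by rewrite mem_cat mem_nseq => /orP[/andP[_ /eqP->]|/smi].
rewrite IHk /fall big_ord_recr /= mulrA count_cat count_nseq /= eqxx mul1n.
by rewrite (count_memPn fs) addn0.
Qed.

Lemma residue_card_gt1 f : monic_irr f -> (1 < residue_card f)%N.
Proof.
case=> _ [f_gt1 _]; have F_gt1 : (1 < #|F|)%N by exact: card_finNzRing_gt1.
rewrite /residue_card -{1}(expn0 #|F|) ltn_exp2l //.
by case: (size f) f_gt1 => [|[]].
Qed.

End Real.

(** [n.+1] copies of the simple module do not fit in dimension [n], so the product [fall] vanishes,
    and a vanishing factor exhibits the count as a power. *)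
Lemma num_hom_expn n (A : 'M[F]_n) f : monic_irr f ->
  exists r, num_hom (companionmx f) A = (residue_card f ^ r)%N.
Proof.
move=> f_mi; have := @num_emb_nseq rat n A f [::] n.+1 f_mi.
rewrite in_nil cats0 => /(_ (fun g h => match notF h with end) isT).
rewrite num_emb_nil mul1r emb_rank; last first.
  have d0 : (0 < (size f).-1)%N by case: f_mi => _ []; case: (size f) => [|[]].
  have -> : forall k, cdim (nseq k f) = (k * (size f).-1)%N.
    by elim=> //= k ->; rewrite mulSn.
  by rewrite leq_pmulr.
move/esym/eqP; rewrite /fall prodf_seq_eq0 => /hasP[a _ /=].
by rewrite subr_eq0 -natrX eqr_nat => /eqP ->; exists a.
Qed.

End Companion.

Section CharCount.
Variables (F : finFieldType) (R : realFieldType).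

(** By orbit counting, the sum of [1 / |Aut M|] over the [F[t]]-modules [M] of dimension [n] with
    characteristic polynomial [G]. *)
Definition char_count n (G : {poly F}) : R :=
  (\sum_(B : 'M[F]_n | char_poly B == G) 1)%N%:R / (gl_order F n)%:R.

Lemma gl_neq0 n : (gl_order F n)%:R != 0 :> R.
Proof. by rewrite pnatr_eq0 -lt0n gl_order_gt0. Qed.

Lemma char_count1 : char_count 0 1 = 1.
Proof.
rewrite /char_count /gl_order !(big_pred1 0) ?divr1 // => B /=.
  by rewrite [B]thinmx0 eqxx unitmxE det_mx00 unitr1.
by rewrite [B]thinmx0 eqxx /char_poly det_mx00 eqxx.
Qed.

Variables (f G : {poly F}) (m : nat).
Hypotheses (f_mi : monic_irr f) (Gm : G \is monic) (sG : size G = m.+1) (cfG : coprimep f G).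
Let d := (size f).-1.
Let q : R := (residue_card f)%:R.

Let q_gt1 : 1 < q. Proof. by rewrite ltr1n residue_card_gt1. Qed.

Lemma cdim_nseq k : cdim (nseq k f) = (k * d)%N.
Proof. by elim: k => //= k ->. Qed.

Lemma char_poly_nseq k : char_poly (cmx (nseq k f)) = f ^+ k.
Proof.
rewrite char_poly_cmx => [|g]; last by rewrite mem_nseq => /andP[_ /eqP ->]; case: f_mi.
by elim: k => [|k IHk]; rewrite ?big_nil //= big_cons IHk exprS.
Qed.

Lemma num_emb_nseq_char a k : (k <= a)%N ->
  (\sum_(B : 'M[F]_(a * d + m) | char_poly B == (f ^+ a * G)%R)
     num_emb (cmx (nseq k f)) B)%N%:R / (gl_order F (a * d + m))%:R =
  char_count ((a - k) * d + m) (f ^+ (a - k) * G).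
Proof.
move=> le_ka; have e : (a * d + m = cdim (nseq k f) + ((a - k) * d + m))%N.
  by rewrite cdim_nseq addnA -mulnDl subnKC.
rewrite e; have := sum_num_emb_char ((a - k) * d + m) (cmx (nseq k f)) (f ^+ a * G).
rewrite /char_count.
have -> : (\sum_(B' : 'M[F]_((a - k) * d + m) | (char_poly (cmx (nseq k f)) * char_poly B')%R == (f ^+ a * G)%R) 1 =
           \sum_(B' : 'M[F]_((a - k) * d + m) | char_poly B' == (f ^+ (a - k) * G)%R) 1)%N.
  apply: eq_bigl => B; rewrite char_poly_nseq -[in f ^+ a](subnKC le_ka) exprD -mulrA.
  rewrite (inj_eq (mulfI _)) // expf_neq0 // monic_neq0 //; exact: f_mi.1.
move/(congr1 (fun k => k%:R : R)); rewrite !natrM => eqS.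
by apply/eqP; rewrite eqr_div ?gl_neq0 // eqS mulrC.
Qed.

(** [r] copies of the simple module embed because [fall (q ^+ r) r] is nonzero, so [f ^+ r] divides
    [char_poly B]. *)
Lemma num_hom_pow_le a (B : 'M[F]_(a * d + m)) r :
  char_poly B = f ^+ a * G -> num_hom (companionmx f) B = (residue_card f ^ r)%N ->
  (r <= a)%N.
Proof.
move=> cpB hr; have := @num_emb_nseq F R _ B f [::] r f_mi.
rewrite in_nil cats0 => /(_ (fun g h => match notF h with end) isT).
rewrite num_emb_nil mul1r hr natrX => eqN.
have : num_emb (cmx (nseq r f)) B != 0%N.
  rewrite -(pnatr_eq0 R) eqN fall_expq ?q_gt1 // subnn.
  rewrite !mulf_neq0 ?invr_eq0 ?qfact_neq0 ?q_gt1 // expf_neq0 // gt_eqF //.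
  exact: lt_trans q_gt1.
rewrite /num_emb; case: (pickP (is_emb (cmx (nseq r f)) B)) => [U|none]; last first.
  by rewrite big1 // => U; rewrite none.
move=> /andP[fU /eqP UB] _; have := char_poly_dvd_emb fU UB.
rewrite char_poly_nseq cpB Gauss_dvdpl ?coprimep_expl //.
have f_gt1 := f_mi.2.1; rewrite dvdp_Pexp2l //.
Qed.

(** Each [B] with characteristic polynomial [f ^+ a * G] contributes a Mobius sum at [q ^+ r], where
    [r > 0] because [f] divides [char_poly B] and [r <= a] by [num_hom_pow_le]; such a sum
    vanishes. *)
Lemma char_count_rec a : (0 < a)%N ->
  \sum_(k < a.+1) alpha q k *
    char_count ((a - k) * d + m) (f ^+ (a - k) * G) = 0.
Proof.
move=> a_gt0.
under eq_bigr => k _ do rewrite -num_emb_nseq_char ?leq_ord // natr_sum mulrA mulr_sumr.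
rewrite -mulr_suml exchange_big /= big1 ?mul0r // => B /eqP cpB.
have [r hr] := num_hom_expn B f_mi.
have r_gt0 : (0 < r)%N.
  rewrite lt0n; apply/eqP => r0.
  suff /(num_hom_gt1 f_mi.1 f_mi.2.1) : ~~ coprimep f (char_poly B).
    by rewrite hr r0 expn0 ltnn.
  rewrite (irr_coprimep _ f_mi.2) negbK cpB.
  by rewrite -(prednK a_gt0) exprS -mulrA dvdp_mulr.
rewrite -[RHS](@sum_alpha_fall_eq0 _ q q_gt1 r a); last by rewrite r_gt0 (num_hom_pow_le cpB).
apply: eq_bigr => k _; have := @num_emb_nseq F R _ B f [::] k f_mi.
rewrite in_nil cats0 => /(_ (fun g h => match notF h with end) isT) ->.
by rewrite num_emb_nil mul1r hr natrX.
Qed.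

Lemma char_count_gam a :
  char_count (a * d + m) (f ^+ a * G) = gam q a * char_count m G.
Proof.
have := conv_gam q_gt1 (c := fun a => char_count (a * d + m) (f ^+ a * G)) char_count_rec a.
by move=> ->; rewrite /= expr0 mul1r.
Qed.

End CharCount.

Lemma char_count_prod (F : finFieldType) (R : realFieldType) (r : nat)
    (f : 'I_r -> {poly F}) (j : 'I_r -> nat) (s : seq 'I_r) :
  injective f -> (forall i, monic_irr (f i)) -> uniq s ->
  let G := \prod_(i <- s) f i ^+ j i in
  char_count R (size G).-1 G = \prod_(i <- s) gam (residue_card (f i))%:R (j i).
Proof.
move=> f_inj f_mi; elim: s => [_|i s IHs /= /andP[is_ us]].
  by rewrite /= !big_nil size_poly1 char_count1.
have Gm t : \prod_(i <- t) f i ^+ j i \is monic.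
  by apply: rpred_prod => k _; rewrite rpredX //; case: (f_mi k).
rewrite !big_cons; set G := \prod_(i <- s) _ in IHs *.
have sG : size G = (size G).-1.+1 by rewrite prednK // size_poly_gt0 monic_neq0 // Gm.
have -> : (size (f i ^+ j i * G)).-1 = (j i * (size (f i)).-1 + (size G).-1)%N.
  have fm : f i ^+ j i \is monic by rewrite rpredX // (proj1 (f_mi i)).
  have sf : size (f i ^+ j i) = ((size (f i)).-1 * j i).+1.
    by rewrite -size_exp prednK // size_poly_gt0 monic_neq0.
  by rewrite size_monicM ?monic_neq0 ?Gm // sf sG addSn addnS /= mulnC.
rewrite char_count_gam ?IHs // ?Gm //.
rewrite /G big_seq; elim/big_ind: _ => [|x y cx cy|k ks]; rewrite ?coprimep1 //.
  by rewrite coprimepMr cx.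
rewrite coprimep_expr //.
by apply: monic_irr_coprime => //; apply: contraNneq is_ => /f_inj ->.
Qed.

(** The bound is again a product, so in [of_type_approx] it expands into embedding counts just like
    the sum that it controls. *)
Lemma prod_dist (R : realFieldType) (I : Type) (s : seq I) (a b t : I -> R) :
  (forall i, `|a i| <= 1) -> (forall i, `|a i - b i| <= t i) ->
  `|\prod_(i <- s) a i - \prod_(i <- s) b i| <= \prod_(i <- s) (1 + t i) - 1.
Proof.
move=> a1 abt; have t0 i : 0 <= t i by apply: le_trans (abt i).
have b1 i : `|b i| <= 1 + t i.
  rewrite -[b i](subrK (a i)) (le_trans (ler_normD _ _)) // addrC lerD //.
  by rewrite distrC.
elim: s => [|i s IHs]; first by rewrite !big_nil !subrr normr0.
rewrite !big_cons; set x := \prod_(j <- s) a j in IHs *.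
set y := \prod_(j <- s) b j in IHs *; set z := \prod_(j <- s) (1 + t j) in IHs *.
have yz : `|y| <= z by rewrite normr_prod; apply: ler_prod => j _; rewrite normr_ge0 b1.
have -> : a i * x - b i * y = a i * (x - y) + (a i - b i) * y by ring.
rewrite (le_trans (ler_normD _ _)) // !normrM.
have : `|a i| * `|x - y| <= z - 1.
  by rewrite -[leRHS]mul1r ler_pM.
have : `|a i - b i| * `|y| <= t i * z by rewrite ler_pM.
lra.
Qed.

(** * The event expressed through embedding counts *)

Section Types.
Variables (F : finFieldType) (R : realFieldType) (r : nat).
Variables (f : 'I_r -> {poly F}) (j : 'I_r -> nat).
Hypotheses (f_inj : injective f) (f_mi : forall i, monic_irr (f i)).

Definition type_poly : {poly F} := \prod_(i < r) f i ^+ j i.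
Definition type_dim : nat := (size type_poly).-1.
Local Notation G := type_poly.
Local Notation m := type_dim.
Local Notation Q := #|F|.

Lemma type_monic : G \is monic.
Proof. by apply: rpred_prod => k _; rewrite rpredX //; case: (f_mi k). Qed.

Lemma size_type : size G = m.+1.
Proof. by rewrite /m prednK // size_poly_gt0 monic_neq0 // type_monic. Qed.

Definition of_type n (A : 'M[F]_n) : bool :=
  (G %| char_poly A) && [forall i, ~~ (f i %| char_poly A %/ G)].

Definition block_seq (k : 'I_r -> nat) : seq {poly F} :=
  flatten [seq nseq (k i) (f i) | i <- index_enum 'I_r].

Lemma num_hom_eq1 n g (A : 'M[F]_n) : monic_irr g ->
  (num_hom (companionmx g) A == 1%N) = ~~ (g %| char_poly A).
Proof.
move=> g_mi; have [gm girr] := g_mi; rewrite -irr_coprimep //; apply/eqP/idP => [h1|cg].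
  by apply/negPn/negP => /(num_hom_gt1 gm girr.1); rewrite h1.
by rewrite num_hom_coprime // companionmxK.
Qed.

Lemma num_emb_blocks n (A : 'M[F]_n) (k : 'I_r -> nat) :
  (num_emb (cmx (block_seq k)) A)%:R =
  \prod_(i < r) fall (residue_card (f i))%:R (num_hom (companionmx (f i)) A)%:R (k i) :> R.
Proof.
rewrite /block_seq; move: (index_enum_uniq 'I_r); elim: (index_enum _) => [_|i s IHs].
  by rewrite big_nil num_emb_nil.
move=> /= /andP[nis us]; rewrite num_emb_nseq //.
- by rewrite IHs // big_cons mulrC.
- move=> g /flattenP[t /mapP[l _ ->]]; rewrite mem_nseq => /andP[_ /eqP ->].
  exact: f_mi.
apply: contra nis => /flattenP[t /mapP[l ls ->]]; rewrite mem_nseq => /andP[_ /eqP].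
by move/f_inj => ->.
Qed.

(* Up to the factor absorbed in [chain_sum], this counts the flags U <= U' of stable
   subspaces where U has characteristic polynomial [type_poly] and U' / U comes with
   an isomorphism to the semisimple module with k i summands of type f i. *)
Definition chain_count k n (A : 'M[F]_n) : nat :=
  (\sum_(B : 'M[F]_m | char_poly B == G)
     \sum_(C : 'M[F]_(cdim (block_seq k), m))
       num_emb (block_mx B 0 C (cmx (block_seq k))) A)%N.

Definition chain_sum K (b : 'I_r -> nat -> R) n (A : 'M[F]_n) : R :=
  \sum_(k : {ffun 'I_r -> 'I_K}) (\prod_i b i (k i)) *
    ((chain_count (fun i => k i) A)%:R / (Q ^ (cdim (block_seq (fun i => k i)) * m))%:R).

Lemma chain_count_quo k n (A : 'M[F]_(m + n)) :
  (chain_count k A)%:R / (Q ^ (cdim (block_seq k) * m))%:R =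
  \sum_(B : 'M[F]_m | char_poly B == G) \sum_(U | is_emb B A U)
    \prod_i fall (residue_card (f i))%:R
      (num_hom (companionmx (f i)) (quo U A))%:R (k i) :> R.
Proof.
have Q0 l : (Q ^ l)%:R != 0 :> R.
  by rewrite pnatr_eq0 expn_eq0 negb_and -lt0n (ltnW (card_finNzRing_gt1 _)).
rewrite /chain_count natr_sum mulr_suml; apply: eq_bigr => B _.
rewrite num_emb_chain natr_sum mulr_suml; apply: eq_bigr => U _.
by rewrite natrM mulrAC divff // mul1r num_emb_blocks.
Qed.

Lemma chain_sum_quo K b n (A : 'M[F]_(m + n)) :
  chain_sum K b A = \sum_(B : 'M[F]_m | char_poly B == G) \sum_(U | is_emb B A U)
    \prod_i \sum_(k < K) b i k *
      fall (residue_card (f i))%:R (num_hom (companionmx (f i)) (quo U A))%:R k.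
Proof.
rewrite /chain_sum.
transitivity (\sum_(k : {ffun 'I_r -> 'I_K}) \sum_(B : 'M[F]_m | char_poly B == G)
   \sum_(U | is_emb B A U) \prod_i (b i (k i) * fall (residue_card (f i))%:R
      (num_hom (companionmx (f i)) (quo U A))%:R (k i))).
  apply: eq_bigr => k _; rewrite chain_count_quo mulr_sumr; apply: eq_bigr => B _.
  by rewrite mulr_sumr; apply: eq_bigr => U _; rewrite -big_split.
rewrite exchange_big; apply: eq_bigr => B _; rewrite exchange_big; apply: eq_bigr => U _.
by rewrite bigA_distr_bigA.
Qed.

Lemma of_type_quo n (A : 'M[F]_(m + n)) B U : char_poly B == G -> is_emb B A U ->
  of_type A = [forall i, num_hom (companionmx (f i)) (quo U A) == 1%N].
Proof.
move=> /eqP cpB /andP[fU /eqP UA]; rewrite /of_type (char_poly_quo fU UA) cpB.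
rewrite dvdp_mulr //= mulKp ?monic_neq0 ?type_monic //.
by apply: eq_forallb => i; rewrite num_hom_eq1.
Qed.

Lemma of_type_count n (A : 'M[F]_n) : of_type A ->
  (\sum_(B : 'M[F]_m | char_poly B == G) num_emb B A)%N = gl_order F m.
Proof.
move=> /andP[/divpK GA /forallP cop].
apply: (num_emb_primary (H := char_poly A %/ G)); rewrite ?size_type ?type_monic //.
  by rewrite mulrC GA.
rewrite {1}/type_poly; elim/big_ind: _ => [|x y cx cy|i _]; rewrite ?coprime1p //.
  by rewrite coprimepMl cx.
by rewrite coprimep_expl // irr_coprimep ?cop //; case: (f_mi i).
Qed.

(** If [A] is of type [j], each pair of [B] and [U] leaves a quotient without [f i]-torsion, and
    there are [gl_order F m] pairs. Otherwise every quotient keeps some torsion and each product has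
    a zero factor. *)
Lemma of_type_sum n (A : 'M[F]_(m + n)) :
  (gl_order F m)%:R * (of_type A)%:R =
  \sum_(B : 'M[F]_m | char_poly B == G) \sum_(U | is_emb B A U)
    \prod_i (num_hom (companionmx (f i)) (quo U A) == 1%N)%:R :> R.
Proof.
transitivity (\sum_(B : 'M[F]_m | char_poly B == G) \sum_(U | is_emb B A U)
    (of_type A)%:R : R); last first.
  apply: eq_bigr => B cpB; apply: eq_bigr => U emb.
  rewrite (of_type_quo cpB emb); case: forallP => [all1|/forallP].
    by rewrite big1 // => i _; rewrite all1.
  by rewrite negb_forall => /existsP[i ni]; rewrite (bigD1 i) //= (negPf ni) mul0r.
have [tA|ntA] := boolP (of_type A); last first.
  by rewrite mulr0 big1 // => B _; rewrite big1.
rewrite mulr1 -(of_type_count tA) natr_sum; apply: eq_bigr => B _.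
by rewrite /num_emb natr_sum.
Qed.

Variable K : nat.

Definition mobius_coef (i : 'I_r) (k : nat) : R := alpha (residue_card (f i))%:R k.
(** Chosen to make the inner sum over [k < K.+2] equal to [1] plus the first omitted Bonferroni
    term. *)
Definition error_coef (i : 'I_r) (k : nat) : R :=
  if k == 0%N then 1 else
  if k == K.+1 then (qfact (residue_card (f i))%:R K.+1)^-1 else 0.
(** With one term, [chain_sum 1] merely counts the pairs of [B] and [U]; it supplies the [- 1] of
    [prod_dist]. *)
Definition unit_coef (i : 'I_r) (k : nat) : R := 1.

(** For each [U], the indicator of a torsion-free quotient is a product over [i];
    [sum_alpha_fall_err] approximates each factor and [prod_dist] combines the errors. *)
Lemma of_type_approx n (A : 'M[F]_n) : (m <= n)%N ->
  `|(gl_order F m)%:R * (of_type A)%:R - chain_sum K.+1 mobius_coef A|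
  <= chain_sum K.+2 error_coef A - chain_sum 1 unit_coef A.
Proof.
move=> le_mn; move: A; rewrite -(subnKC le_mn) => A.
rewrite of_type_sum !chain_sum_quo -!sumrB.
apply: le_trans (ler_norm_sum _ _ _) _; apply: ler_sum => B _.
rewrite -!sumrB; apply: le_trans (ler_norm_sum _ _ _) _; apply: ler_sum => U _.
set X := fun i => (num_hom (companionmx (f i)) (quo U A)).
set q := fun i => (residue_card (f i))%:R : R.
rewrite [X in _ <= _ - X]big1 => [|i _]; last first.
  by rewrite big_ord_recl big_ord0 addr0 mul1r /fall big_ord0.
pose t i : R := (qfact (q i) K.+1)^-1 * fall (q i) (X i)%:R K.+1.
have -> : \prod_i \sum_(k < K.+2) error_coef i k * fall (q i) (X i)%:R k =
          \prod_i (1 + t i).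
  apply: eq_bigr => i _; rewrite big_ord_recl big_ord_recr /= big1 => [|k _].
    by rewrite /error_coef /= eqxx /fall big_ord0 mulr1 add0r.
  by rewrite /error_coef /= /bump /= add1n eqSS ltn_eqF ?mul0r.
apply: prod_dist => i; first by case: eqP; rewrite ?normr1 ?normr0.
have [a ha] := num_hom_expn (quo U A) (f_mi i).
have q1 : 1 < q i by rewrite ltr1n residue_card_gt1.
rewrite distrC /t /X ha natrX; have := sum_alpha_fall_err q1 a K.
congr (`| _ - _ | <= _); congr (nat_of_bool _)%:R.
by rewrite -(expn0 (residue_card (f i))) eqn_exp2l // residue_card_gt1.
Qed.

End Types.


(** * Universality of the moments *)

Section Contraction.
Variables (R : realFieldType) (p : nat).
Hypothesis p_prime : prime p.
Local Notation F := 'F_p.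
Implicit Types (h : F -> R) (t : F).

Definition dirichlet h t : R := \sum_y (h y - h (y + t)) ^+ 2.

Lemma dirichlet_ge0 h t : 0 <= dirichlet h t.
Proof. by apply: sumr_ge0 => y _; rewrite sqr_ge0. Qed.

Lemma sum_shift (G : F -> R) (t : F) : \sum_y G (y + t) = \sum_y G y.
Proof.
rewrite [RHS](reindex (fun y => y + t)) //=.
by exists (fun y => y - t) => y _; rewrite ?addrK ?subrK.
Qed.

(** Young's inequality [(a + b)^2 <= (1 + 1/k) a^2 + (1 + k) b^2] is weighted so that the induction
    closes: [(1 + 1/k) k^2 + (1 + k) = (k + 1)^2]. *)
Lemma dirichlet_mulrn h t k : dirichlet h (t *+ k) <= k%:R ^+ 2 * dirichlet h t.
Proof.
elim: k => [|k IHk].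
  rewrite mulr0n expr0n mul0r /dirichlet big1 // => y _.
  by rewrite addr0 subrr expr0n.
have [->|k_gt0] := posnP k; first by rewrite mulr1n expr1n mul1r.
have k0 : 0 < k%:R :> R by rewrite ltr0n.
apply: (@le_trans _ _ ((1 + k%:R^-1) * dirichlet h (t *+ k) + (1 + k%:R) * dirichlet h t)).
  have -> : dirichlet h t = \sum_y (h (y + t *+ k) - h (y + t *+ k + t)) ^+ 2.
    by rewrite (sum_shift (fun y => (h y - h (y + t)) ^+ 2)).
  rewrite /dirichlet !mulr_sumr -big_split; apply: ler_sum => y _ /=.
  rewrite mulrSr addrA; set a := h y - h (y + t *+ k); set b := h (y + t *+ k) - h (_ + t).
  have -> : h y - h (y + t *+ k + t) = a + b by rewrite /a /b; ring.
  rewrite -subr_ge0.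
  have -> : (1 + k%:R^-1) * a ^+ 2 + (1 + k%:R) * b ^+ 2 - (a + b) ^+ 2 =
            (a - k%:R * b) ^+ 2 / k%:R by field; rewrite gt_eqF.
  by rewrite divr_ge0 ?sqr_ge0 ?ltW.
have -> : k.+1%:R = k%:R + 1 :> R by rewrite -natr1.
have le1 : (1 + k%:R^-1) * dirichlet h (t *+ k) <= (1 + k%:R^-1) * (k%:R ^+ 2 * dirichlet h t).
  by rewrite ler_wpM2l // addr_ge0 // invr_ge0 ltW.
apply: le_trans (lerD le1 (lexx _)) _.
rewrite le_eqVlt; apply/orP; left; apply/eqP; field; by rewrite gt_eqF.
Qed.

Lemma dirichlet_le h t z : t != 0 -> dirichlet h z <= p%:R ^+ 2 * dirichlet h t.
Proof.
move=> t0; have -> : z = t *+ (z / t)%R.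
  by rewrite -mulr_natr natr_Zp mulrC divfK.
apply: le_trans (dirichlet_mulrn _ _ _) _; rewrite ler_wpM2r ?dirichlet_ge0 //.
rewrite lerXn2r ?nnegrE ?ler0n // ler_nat ltnW //.
by have := ltn_ord (z / t); rewrite [X in (_ < X)%N -> _]Fp_cast.
Qed.

(** Averaged over all shifts, the energy of a mean-zero [h] is twice its squared norm; each shift is
    a multiple of [t], so [dirichlet_le] applies. *)
Lemma poincare h t : t != 0 -> \sum_y h y = 0 ->
  2 * \sum_y h y ^+ 2 <= p%:R ^+ 2 * dirichlet h t.
Proof.
move=> t0 h0; have p0 : 0 < p%:R :> R by rewrite ltr0n prime_gt0.
rewrite -(ler_pM2l p0).
have -> : p%:R * (2 * \sum_y h y ^+ 2) = \sum_(z : F) dirichlet h z.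
  rewrite /dirichlet exchange_big /=.
  have sh (y : F) : \sum_(z : F) (h y - h (y + z)) ^+ 2 =
      h y ^+ 2 *+ p + \sum_(z : F) h z ^+ 2.
    transitivity (\sum_(z : F) (h y - h z) ^+ 2).
      by rewrite -[RHS](sum_shift _ y); apply: eq_bigr => z _; rewrite [_ + y]addrC.
    under eq_bigr => z _ do rewrite sqrrB.
    rewrite big_split /= sumrB sumr_const card_Fp //; congr (_ + _).
    by rewrite sumrMnl -mulr_sumr h0 mulr0 mul0rn subr0.
  under [RHS]eq_bigr => y _ do rewrite sh.
  by rewrite big_split /= sumr_const card_Fp // sumrMnl -mulr_natl; ring.
have -> : p%:R * (p%:R ^+ 2 * dirichlet h t) = \sum_(z : F) p%:R ^+ 2 * dirichlet h t.
  by rewrite sumr_const card_Fp // mulr_natl.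
by apply: ler_sum => z _; exact: dirichlet_le.
Qed.

Variables (eps : R) (mu : F -> R).
Hypotheses (mu_ge0 : forall a, 0 <= mu a) (mu_sum : \sum_a mu a = 1).
Hypothesis mu_le : forall a, mu a <= 1 - eps.
Hypothesis eps_gt0 : 0 < eps.

(** The double sum is the probability that two independent samples differ,
    [\sum_a mu a * (1 - mu a)]. *)
Lemma collision_ge : eps <= \sum_a \sum_(b | b != a) mu a * mu b.
Proof.
have -> : \sum_a \sum_(b | b != a) mu a * mu b = \sum_a mu a * (1 - mu a).
  by apply: eq_bigr => a _; rewrite -mulr_sumr -mu_sum [X in _ = _ * (X - _)](bigD1 a) //= addrC addrK.
rewrite -[leLHS]mul1r -[X in X * eps]mu_sum mulr_suml; apply: ler_sum => a _.
by rewrite ler_wpM2l //; have := mu_le a; lra.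
Qed.

(** Pointwise, squaring an average loses exactly the variance, which is half the mean squared
    difference of two independent samples. *)
Lemma variance_conv h (c : F) : 
  2 * \sum_y (\sum_x mu x * h (y - c * x)) ^+ 2 =
  2 * \sum_y h y ^+ 2 - \sum_a \sum_b mu a * mu b * dirichlet h (c * (a - b)).
Proof.
have pt y : 2 * (\sum_x mu x * h (y - c * x)) ^+ 2 =
    2 * (\sum_x mu x * h (y - c * x) ^+ 2) -
    \sum_a \sum_b mu a * mu b * (h (y - c * a) - h (y - c * b)) ^+ 2.
  set g := fun x => h (y - c * x).
  have -> : \sum_a \sum_b mu a * mu b * (h (y - c * a) - h (y - c * b)) ^+ 2 =
      \sum_a (mu a * g a ^+ 2 - 2 * (mu a * g a) * \sum_b mu b * g b +
               mu a * \sum_b mu b * g b ^+ 2).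
    apply: eq_bigr => a _.
    have -> : mu a * g a ^+ 2 = \sum_b mu b * (mu a * g a ^+ 2).
      by rewrite -mulr_suml mu_sum mul1r.
    rewrite !mulr_sumr -sumrB -big_split; apply: eq_bigr => b _ /=.
    by rewrite -/(g a) -/(g b); ring.
  rewrite big_split sumrB /= -!mulr_suml -!mulr_sumr mu_sum; ring.
rewrite mulr_sumr; under eq_bigr => y _ do rewrite pt.
rewrite sumrB -mulr_sumr exchange_big; congr (_ * _ - _).
  rewrite -[RHS]mul1r -mu_sum mulr_suml; apply: eq_bigr => x _.
  rewrite -mulr_sumr; congr (_ * _).
  by rewrite (sum_shift (fun y => h y ^+ 2)).
rewrite exchange_big; apply: eq_bigr => a _; rewrite exchange_big; apply: eq_bigr => b _.
rewrite -mulr_sumr; congr (_ * _).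
rewrite -(sum_shift _ (c * a)) /dirichlet; apply: eq_bigr => y _.
by rewrite addrK mulrBr addrA.
Qed.

(** Here [eps] is the lower bound on the chance that two samples differ, and [p^2] is the loss in
    [poincare]. *)
Definition theta : R := 1 - eps / p%:R ^+ 2.

Lemma conv_contract h (c : F) : c != 0 -> \sum_y h y = 0 ->
  \sum_y (\sum_x mu x * h (y - c * x)) ^+ 2 <= theta * \sum_y h y ^+ 2.
Proof.
move=> c0 h0; have p0 : 0 < p%:R :> R by rewrite ltr0n prime_gt0.
rewrite -(ler_pM2l (ltr0n R 2)) variance_conv.
set S := \sum_y h y ^+ 2; have S0 : 0 <= S by apply: sumr_ge0 => y _; rewrite sqr_ge0.
have low : \sum_a \sum_(b | b != a) mu a * mu b * (2 * S / p%:R ^+ 2) <=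
    \sum_a \sum_b mu a * mu b * dirichlet h (c * (a - b)).
  apply: ler_sum => a _; rewrite [leRHS](bigID (fun b => b != a)) /= -[leLHS]addr0.
  apply: lerD; last by apply: sumr_ge0 => b _; rewrite !mulr_ge0 ?dirichlet_ge0.
  apply: ler_sum => b ba; rewrite ler_wpM2l ?mulr_ge0 //.
  rewrite ler_pdivrMr ?exprn_gt0 // [leRHS]mulrC poincare //.
  by rewrite mulf_neq0 // subr_eq0 eq_sym.
have := collision_ge; set E := \sum_a _ => Ege.
have {}low : eps * (2 * S / p%:R ^+ 2) <= \sum_a \sum_b mu a * mu b * dirichlet h (c * (a - b)).
  apply: le_trans low; under eq_bigr => a _ do rewrite -mulr_suml.
  by rewrite -mulr_suml ler_wpM2r // !mulr_ge0 // invr_ge0 exprn_ge0 // ltW.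
have -> : 2 * (theta * S) = 2 * S - eps * (2 * S / p%:R ^+ 2) by rewrite /theta; ring.
by rewrite lerB.
Qed.

End Contraction.

(** * Equidistribution of a single column *)

Section ColumnLaw.
Variables (R : rcfType) (p : nat).
Hypothesis p_prime : prime p.
Local Notation F := 'F_p.
Variable eps : R.
Hypothesis eps_gt0 : 0 < eps.
Hypothesis eps_le1 : eps <= 1.

Definition valid_law n (mu : 'I_n -> F -> R) : Prop :=
  [/\ forall i a, 0 <= mu i a, forall i, \sum_a mu i a = 1 &
      forall i a, mu i a <= 1 - eps].

Definition col_weight n (mu : 'I_n -> F -> R) (a : 'cV[F]_n) : R :=
  \prod_i mu i (a i 0).

Definition col_prob k n (mu : 'I_n -> F -> R) (U : 'M[F]_(k, n)) (x : 'cV[F]_k) : R :=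
  \sum_(a : 'cV[F]_n | U *m a == x) col_weight mu a.

Definition hwt n (s : 'rV[F]_n) : nat := (\sum_i (s 0%R i != 0%R))%N.

Lemma big_cV1 (S : Type) (idx : S) (op : Monoid.com_law idx) (P : pred 'cV[F]_1) G :
  \big[op/idx]_(x | P x) G x = \big[op/idx]_(x : F | P x%:M) G x%:M.
Proof.
rewrite (reindex (fun x : F => x%:M : 'cV[F]_1)) //.
exists (fun M : 'cV[F]_1 => M 0 0) => x _; first by rewrite mxE eqxx.
by rewrite -mx11_scalar.
Qed.

Lemma col_weight_cons n (mu : 'I_(1 + n) -> F -> R) x (b : 'cV[F]_n) :
  col_weight mu (col_mx x%:M b) = mu ord0 x * col_weight (fun i => mu (lift ord0 i)) b.
Proof.
rewrite /col_weight big_ord_recl; congr (mu _ _ * _).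
  have -> : ord0 = lshift n (ord0 : 'I_1) by apply: val_inj.
  by rewrite col_mxEu mxE eqxx.
by apply: eq_bigr => i _; rewrite -rshift1 col_mxEd.
Qed.

Lemma col_prob_cons n (mu : 'I_(1 + n) -> F -> R) (c : F) (s : 'rV[F]_n) (y : F) :
  col_prob mu (row_mx c%:M s) y%:M =
  \sum_x mu ord0 x * col_prob (fun i => mu (lift ord0 i)) s (y - c * x)%:M.
Proof.
rewrite /col_prob (@big_col_mx _ _ _ _ 1 n 1) big_cV1; apply: eq_bigr => x _.
rewrite mulr_sumr; apply: eq_big => [b|b _]; last exact: col_weight_cons.
rewrite mul_row_col -scalar_mxM raddfB /= -subr_eq0 -[RHS]subr_eq0.
by rewrite opprB addrA [_ + s *m b]addrC.
Qed.

Lemma hwt_cons n (c : F) (s : 'rV[F]_n) :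
  hwt (row_mx c%:M s : 'rV_(1 + n)) = ((c != 0%R) + hwt s)%N.
Proof.
rewrite /hwt big_ord_recl; congr ((_ != 0) + _)%N.
  have -> : ord0 = lshift n (ord0 : 'I_1) by apply: val_inj.
  by rewrite row_mxEl mxE eqxx.
by apply: eq_bigr => i _; rewrite -rshift1 row_mxEr.
Qed.

Lemma valid_tail n (mu : 'I_(1 + n) -> F -> R) :
  valid_law mu -> valid_law (fun i => mu (lift ord0 i)).
Proof. by case=> *; split. Qed.

Lemma row_mx_ind (P : forall n, 'rV[F]_n -> Prop) :
  P 0%N 0 -> (forall n c (s : 'rV_n), P n s -> P (1 + n)%N (row_mx c%:M s)) ->
  forall n s, P n s.
Proof.
move=> P0 Pcons; elim=> [|n IHn] s; first by rewrite [s]thinmx0.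
rewrite -[s](@hsubmxK _ _ 1) [lsubmx _]mx11_scalar; exact: Pcons.
Qed.

Lemma sum_shiftB (G : F -> R) (t : F) : \sum_y G (y - t) = \sum_y G y.
Proof. exact: (sum_shift G (- t)). Qed.

Lemma col_prob_nil (mu : 'I_0 -> F -> R) (y : F) :
  col_prob mu (0 : 'rV_0) y%:M = (y == 0)%:R.
Proof.
rewrite /col_prob; have [->|y0] := eqVneq y 0.
  rewrite (big_pred1 0) => [|a]; first by rewrite /col_weight big_ord0.
  by rewrite [a]flatmx0 mul0mx raddf0 /= !eqxx.
rewrite big1 // => a; rewrite mul0mx eq_sym => /eqP/matrixP/(_ 0 0).
by rewrite !mxE eqxx => e; rewrite (e : y = 0) eqxx in y0.
Qed.

Lemma col_prob_sum n (mu : 'I_n -> F -> R) (s : 'rV[F]_n) : valid_law mu ->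
  \sum_(y : F) col_prob mu s y%:M = 1.
Proof.
move: n s mu; apply: row_mx_ind => [|n c s IHs] mu [mu0 mu1 mule].
  rewrite (bigD1 0) //= big1 => [|y y0]; rewrite col_prob_nil ?eqxx ?addr0 //.
  by rewrite (negPf y0).
under eq_bigr => y _ do rewrite col_prob_cons.
rewrite exchange_big -[RHS](mu1 ord0); apply: eq_bigr => x _.
rewrite -mulr_sumr (sum_shiftB (fun z => col_prob _ s z%:M)) IHs ?mulr1 //.
Qed.

Lemma col_prob_ge0 k n (mu : 'I_n -> F -> R) (U : 'M[F]_(k, n)) x : valid_law mu ->
  0 <= col_prob mu U x.
Proof. by case=> mu0 _ _; apply: sumr_ge0 => a _; apply: prodr_ge0. Qed.

(** Conditionally on the other entries, an entry with a nonzero coefficient must take one prescribed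
    value. *)
Lemma col_prob_le n (mu : 'I_n -> F -> R) (s : 'rV[F]_n) y : valid_law mu ->
  s != 0 -> col_prob mu s y <= 1 - eps.
Proof.
rewrite [y]mx11_scalar; move: (y 0 0) => {}y.
move: n s mu y; apply: row_mx_ind => [|n c s IHs] mu y vmu; first by rewrite eqxx.
have [mu0 mu1 mule] := vmu; have vmu' := valid_tail vmu; rewrite col_prob_cons.
have [->|c0] := eqVneq c 0; last first.
  move=> _; apply: (@le_trans _ _ (\sum_x (1 - eps) *
      col_prob (fun i => mu (lift ord0 i)) s (y - c * x)%:M)).
    by apply: ler_sum => x _; rewrite ler_wpM2r ?col_prob_ge0.
  rewrite -mulr_sumr (reindex_inj (h := fun z => c^-1 * (y - z))) /=.
    rewrite (eq_bigr (fun z => col_prob (fun i => mu (lift ord0 i)) s z%:M)) => [|z _].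
      by rewrite col_prob_sum ?mulr1.
    by rewrite mulrA divff // mul1r opprB addrC subrK.
  by move=> z w /(mulfI (invr_neq0 c0))/addrI/oppr_inj.
move=> s0; have {}s0 : s != 0.
  by apply: contraNneq s0 => ->; rewrite raddf0 row_mx0.
under eq_bigr => x _ do rewrite mul0r subr0.
by rewrite -mulr_suml mu1 mul1r IHs.
Qed.

Lemma theta_ge0 : 0 <= theta p eps.
Proof.
have p1 : 1 <= p%:R :> R by rewrite ler1n prime_gt0.
rewrite /theta subr_ge0 ler_pdivrMr ?exprn_gt0 ?(lt_le_trans ltr01) // mul1r.
by rewrite (le_trans eps_le1) // exprn_ege1.
Qed.

(** The law of [s *m a] arises by one convolution per coordinate, and [conv_contract] gives a factor
    [theta] for each nonzero coefficient. *)
Lemma col_prob_L2 n (mu : 'I_n -> F -> R) (s : 'rV[F]_n) : valid_law mu ->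
  \sum_(y : F) (col_prob mu s y%:M - p%:R^-1) ^+ 2 <= theta p eps ^+ hwt s.
Proof.
have p0 : 0 < p%:R :> R by rewrite ltr0n prime_gt0.
have pinv : \sum_(y : F) p%:R^-1 = 1 :> R.
  by rewrite sumr_const card_Fp // -[LHS]mulr_natl divff // gt_eqF.
move: n s mu; apply: row_mx_ind => [|n c s IHs] mu vmu.
  rewrite /hwt big_ord0 expr0.
  under eq_bigr => y _ do rewrite col_prob_nil.
  have -> : \sum_(y : F) ((y == 0)%:R - p%:R^-1) ^+ 2 =
      \sum_(y : F) ((y == 0)%:R * (1 - 2 * p%:R^-1) + p%:R^-1 * p%:R^-1) :> R.
    by apply: eq_bigr => y _; case: (y == 0); rewrite /=; ring.
  rewrite big_split /= -mulr_suml -mulr_suml pinv (bigD1 0) //= big1 => [|y /negPf -> //].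
  have : 0 < p%:R^-1 :> R by rewrite invr_gt0.
  by move=> pinv0; rewrite addr0 mul1r; lra.
have vmu' := valid_tail vmu; have [mu0 mu1 mule] := vmu.
pose h (y : F) := col_prob (fun i => mu (lift ord0 i)) s y%:M - p%:R^-1.
have hy (y : F) : col_prob mu (row_mx c%:M s) y%:M - p%:R^-1 =
    \sum_x mu ord0 x * h (y - c * x).
  rewrite col_prob_cons /h; under [RHS]eq_bigr => x _ do rewrite mulrBr.
  by rewrite sumrB -mulr_suml mu1 mul1r.
under eq_bigr => y _ do rewrite hy.
have h0 : \sum_y h y = 0 by rewrite sumrB col_prob_sum // pinv subrr.
have IH := IHs _ vmu'; rewrite hwt_cons; have [->|c0] := eqVneq c 0.
  rewrite add0n; apply: le_trans IH.
  apply: ler_sum => y _; under eq_bigr => x _ do rewrite mul0r subr0.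
  by rewrite -mulr_suml mu1 mul1r.
rewrite exprS; apply: (@le_trans _ _ (theta p eps * \sum_y h y ^+ 2)).
  exact: conv_contract.
by rewrite ler_wpM2l // theta_ge0.
Qed.

(** The square root appears because a deviation at one point is bounded by the L2 distance. *)
Definition rho : R := Num.sqrt (theta p eps).

Lemma rho_ge0 : 0 <= rho. Proof. exact: sqrtr_ge0. Qed.

Lemma rho_lt1 : rho < 1.
Proof.
rewrite -[ltRHS]sqrtr1 ltr_sqrt // /theta gtrBl divr_gt0 // exprn_gt0 //.
by rewrite ltr0n prime_gt0.
Qed.

Lemma col_prob_equi n (mu : 'I_n -> F -> R) (s : 'rV[F]_n) y : valid_law mu ->
  `|col_prob mu s y - p%:R^-1| <= rho ^+ hwt s.
Proof.
move=> vmu; rewrite [y]mx11_scalar; move: (y 0 0) => {}y.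
rewrite -(@ler_pXn2r _ 2) ?nnegrE ?normr_ge0 ?exprn_ge0 ?rho_ge0 //.
rewrite real_normK ?num_real // -exprM mulnC exprM sqr_sqrtr ?theta_ge0 //.
apply: le_trans (col_prob_L2 s vmu); rewrite (bigD1 y) //= lerDl.
by apply: sumr_ge0 => z _; rewrite sqr_ge0.
Qed.

Lemma count_orth k (z : 'cV[F]_k) :
  p%:R * \sum_(e : 'rV[F]_k) (e *m z == 0)%:R =
  p%:R ^+ k * (1 + (z == 0)%:R * (p%:R - 1)) :> R.
Proof.
have cardV : \sum_(e : 'rV[F]_k) 1 = p%:R ^+ k :> R.
  by rewrite sumr_const card_mx card_Fp // mul1n natrX.
have [->|z0] := eqVneq z 0.
  under eq_bigr => e _ do rewrite mulmx0 eqxx.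
  rewrite cardV /=; ring.
rewrite mul0r addr0 mulr1 -cardV.
have /cV0Pn[i zi] := z0.
(* Translation by [e0] makes all values of [e *m z] equally frequent. *)
have shift (c : F) : \sum_(e : 'rV[F]_k) (e *m z == c%:M)%:R =
    \sum_(e : 'rV[F]_k) (e *m z == 0)%:R :> R.
  pose e0 : 'rV[F]_k := (c / z i 0) *: delta_mx 0 i.
  have e0z : e0 *m z = c%:M.
    rewrite -scalemxAl -rowE [row i z]mx11_scalar mxE scale_scalar_mx.
    by rewrite divfK.
  rewrite (reindex_inj (addIr e0)); apply: eq_bigr => e _.
  by rewrite mulmxDl e0z -[X in _ == X]add0r (inj_eq (addIr _)).
have -> : p%:R = \sum_(c : F) 1 :> R by rewrite sumr_const card_Fp.
rewrite mulr_suml; under eq_bigr => c _ do rewrite mul1r -(shift c).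
rewrite exchange_big; apply: eq_bigr => e _.
rewrite (bigD1 ((e *m z) 0 0)) //= -mx11_scalar eqxx big1 ?addr0 // => c cn.
case: eqP => // eq_c; move: cn; rewrite eq_c mxE eqxx.
by rewrite eqxx.
Qed.

End ColumnLaw.

Section ColumnBound.
Variables (R : rcfType) (p : nat).
Hypothesis p_prime : prime p.
Local Notation F := 'F_p.
Variable eps : R.
Hypothesis eps_gt0 : 0 < eps.
Hypothesis eps_le1 : eps <= 1.
Local Notation P := (p%:R : R).
Local Notation rho := (rho p eps).

Let P_gt0 : 0 < P. Proof. by rewrite ltr0n prime_gt0. Qed.
Let P_ge2 : 2 <= P. Proof. by rewrite ler_nat prime_gt1. Qed.

Section Law.
Variables (n : nat) (mu : 'I_n -> F -> R).
Hypothesis vmu : valid_law eps mu.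

Lemma col_weight_sum : \sum_(a : 'cV[F]_n) col_weight mu a = 1.
Proof.
rewrite -(col_prob_sum 0 vmu) [RHS](bigD1 0) //= [X in _ = _ + X]big1 ?addr0 => [|y y0].
  rewrite /col_prob; apply: eq_bigl => a; rewrite mul0mx; apply/esym/eqP/matrixP => i k.
  by rewrite !mxE mul0rn.
rewrite /col_prob big1 // => a; rewrite mul0mx eq_sym => /eqP/matrixP/(_ 0 0).
by rewrite !mxE eqxx => e; rewrite (e : y = 0) eqxx in y0.
Qed.

Lemma col_prob00 k : col_prob mu (0 : 'M[F]_(k, n)) 0 = 1.
Proof.
by rewrite -col_weight_sum; apply: eq_bigl => a; rewrite mul0mx eqxx.
Qed.

Lemma col_weight_ge0 a : 0 <= col_weight mu a.
Proof. by case: vmu => mu0 _ _; apply: prodr_ge0. Qed.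

Lemma col_prob_mull k l (K : 'M[F]_(l, k)) (V : 'M[F]_(k, n)) v :
  col_prob mu V v <= col_prob mu (K *m V) (K *m v).
Proof.
rewrite /col_prob [leRHS](bigID (fun a => V *m a == v)) /=.
rewrite [X in X + _](eq_bigl (fun a => V *m a == v)) => [|a].
  by rewrite lerDl sumr_ge0 // => a _; exact: col_weight_ge0.
by case: (V *m a =P v) => [<-|_]; rewrite ?andbF // mulmxA eqxx.
Qed.

(* Elementary substitute for Fourier inversion on F^k. *)
Lemma col_prob_inversion k (V : 'M[F]_(k, n)) v :
  P ^+ k * (1 - P^-1) * col_prob mu V v =
  (1 - P^-1) + \sum_(e : 'rV[F]_k | e != 0) (col_prob mu (e *m V) (e *m v) - P^-1).
Proof.
have all : P * \sum_(e : 'rV[F]_k) col_prob mu (e *m V) (e *m v) =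
    P ^+ k * (1 + (P - 1) * col_prob mu V v).
  transitivity (\sum_(a : 'cV[F]_n) col_weight mu a *
      (P ^+ k * (1 + (V *m a - v == 0)%:R * (P - 1)))).
    rewrite /col_prob; under eq_bigr => e _ do rewrite big_mkcond.
    rewrite exchange_big mulr_sumr; apply: eq_bigr => a _.
    rewrite -count_orth // mulrCA; congr (_ * _); rewrite mulr_sumr.
    apply: eq_bigr => e _; rewrite mulmxBr mulmxA subr_eq0.
    by case: eqP; rewrite ?mulr1 ?mulr0.
  under eq_bigr => a _ do rewrite mulrDr mulrDr mulr1.
  rewrite big_split /= -mulr_suml col_weight_sum mul1r mulrDr mulr1; congr (_ + _).
  rewrite /col_prob [X in _ = _ * (_ * X)]big_mkcond !mulr_sumr; apply: eq_bigr => a _.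
  by rewrite subr_eq0; case: eqP => _ /=; rewrite ?mul0r ?mulr0 //; ring.
have cardV : \sum_(e : 'rV[F]_k) P^-1 = P ^+ k * P^-1.
  by rewrite sumr_const card_mx card_Fp // mul1n -[LHS]mulr_natl natrX.
have := cardV; rewrite (bigD1 0) //= => /(canRL (addKr _)) cV.
move: all; rewrite (bigD1 0) //= !mul0mx col_prob00 sumrB cV.
set S := \sum_(e | _) _; set pr := col_prob _ _ _ => eqS.
have -> : S = P ^+ k * (1 + (P - 1) * pr) / P - 1.
  by rewrite -eqS; field; rewrite gt_eqF.
by field; rewrite gt_eqF.
Qed.

(** In the difference of the inversion formulas for [U] and [K *m U], the combinations in the row
    space of [K] cancel; each of the others contributes at most [rho ^+ N]. *)
Lemma col_prob_split k m (K : 'M[F]_(k, m)) (U : 'M[F]_(m, n)) x N :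
  row_free K ->
  (forall c : 'rV[F]_m, ~~ (c <= K)%MS -> (N <= hwt (c *m U)%R)%N) ->
  `|P ^+ m * col_prob mu U x - P ^+ k * col_prob mu (K *m U) (K *m x)|
  <= 2 * P ^+ m * rho ^+ N.
Proof.
move=> fK heavy; pose g (c : 'rV[F]_m) := col_prob mu (c *m U) (c *m x) - P^-1.
have P1 : 0 < 1 - P^-1 by rewrite subr_gt0 invf_lt1 // (lt_le_trans _ P_ge2) // ltr1n.
have eqd : (1 - P^-1) * (P ^+ m * col_prob mu U x - P ^+ k * col_prob mu (K *m U) (K *m x)) =
    \sum_(c : 'rV[F]_m | ~~ (c <= K)%MS) g c.
  have e1 := col_prob_inversion (K *m U) (K *m x).
  have e2 := col_prob_inversion U x.
  have split : \sum_(c : 'rV[F]_m | c != 0) g c =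
      \sum_(e : 'rV[F]_k | e != 0) (col_prob mu (e *m (K *m U)) (e *m (K *m x)) - P^-1) +
      \sum_(c : 'rV[F]_m | ~~ (c <= K)%MS) g c.
    rewrite [LHS](bigID (fun c => (c <= K)%MS)) /=; congr (_ + _).
      rewrite (reindex_onto (fun e => e *m K) (fun c => c *m pinvmx K)) /=; last first.
        by move=> c /andP[_ cK]; rewrite mulmxKpV.
      apply: eq_big => [e|e _]; last by rewrite /g !mulmxA.
      by rewrite mulmx_free_eq0 // submxMl mulmxKp // eqxx !andbT.
    apply: eq_bigl => c; case: (boolP (c <= K)%MS) => cK; rewrite ?andbF ?andbT //.
    by apply: contraNneq cK => ->; rewrite sub0mx.
  rewrite split in e2; rewrite mulrBr !mulrA ![(1 - _) * P ^+ _]mulrC e1 e2; ring.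
have gle c : ~~ (c <= K)%MS -> `|g c| <= rho ^+ N.
  move=> cK; apply: (@le_trans _ _ (rho ^+ hwt (c *m U))).
    exact: col_prob_equi.
  by rewrite ler_wiXn2l ?rho_ge0 ?ltW ?rho_lt1 ?heavy.
have sumle : `|\sum_(c : 'rV[F]_m | ~~ (c <= K)%MS) g c| <= P ^+ m * rho ^+ N.
  apply: le_trans (ler_norm_sum _ _ _) _.
  apply: (@le_trans _ _ (\sum_(c : 'rV[F]_m) rho ^+ N)).
    rewrite [leRHS](bigID (fun c : 'rV[F]_m => (c <= K)%MS)) /=.
    rewrite ler_wpDl ?sumr_ge0 // => [c _|]; first by rewrite exprn_ge0 ?rho_ge0.
    exact: ler_sum.
  by rewrite sumr_const card_mx card_Fp // mul1n -[leLHS]mulr_natl natrX.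
move: sumle; rewrite -eqd normrM (gtr0_norm P1) mulrC -ler_pdivlMr // => /le_trans; apply.
(* The factor 2 bounds [(1 - p^-1)^-1], as [p >= 2]. *)
rewrite ler_pdivrMr // -!mulrA [2 * _]mulrC -!mulrA ler_pM2l ?exprn_gt0 //.
rewrite ler_peMr ?exprn_ge0 ?rho_ge0 //.
have : P^-1 <= 2^-1 by rewrite lef_pV2 ?posrE.
lra.
Qed.

End Law.
End ColumnBound.

Lemma sum_prod_rows (F : finFieldType) (R : comPzSemiRingType) k n
    (h : 'I_k -> 'rV[F]_n -> R) :
  \sum_(A : 'M[F]_(k, n)) \prod_i h i (row i A) = \prod_i \sum_s h i s.
Proof.
rewrite bigA_distr_bigA (reindex (fun c : {ffun 'I_k -> 'rV[F]_n} => \matrix_i c i)) /=.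
  by apply: eq_bigr => c _; apply: eq_bigr => i _; rewrite rowK.
exists (fun A => [ffun i => row i A]) => A _.
  by apply/ffunP => i; rewrite ffunE rowK.
by apply/row_matrixP => i; rewrite rowK ffunE.
Qed.

Lemma sum_prod_cols (F : finFieldType) (R : comPzSemiRingType) k n
    (h : 'I_n -> 'cV[F]_k -> R) :
  \sum_(A : 'M[F]_(k, n)) \prod_j h j (col j A) = \prod_j \sum_a h j a.
Proof.
have tr_bij a b : bijective (@trmx F a b).
  by exists (@trmx F b a) => A; rewrite trmxK.
rewrite (reindex (@trmx F n k)) /=; last exact: onW_bij (tr_bij _ _).
under eq_bigr => A _ do under eq_bigr => j _ do rewrite -tr_row.
rewrite (sum_prod_rows (fun j s => h j s^T)); apply: eq_bigr => j _.
by rewrite [RHS](reindex (@trmx F 1 k)) //; exact: onW_bij (tr_bij _ _).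
Qed.

(** * Moments of the random matrix *)

Section MatrixLaw.
Variables (R : rcfType) (p : nat).
Hypothesis p_prime : prime p.
Local Notation F := 'F_p.
Variable eps : R.
Hypothesis eps_gt0 : 0 < eps.
Hypothesis eps_le1 : eps <= 1.
Local Notation P := (p%:R : R).
Local Notation rho := (rho p eps).

Let P_gt0 : 0 < P. Proof. by rewrite ltr0n prime_gt0. Qed.
Let P_ge1 : 1 <= P. Proof. by rewrite ler1n prime_gt0. Qed.

Definition light M n (s : 'rV[F]_n) : bool := (hwt s * M < n)%N.

Definition num_light M n : nat := (\sum_(s : 'rV[F]_n | light M s) 1)%N.

Definition light_rows M k n (V : 'M[F]_(k, n)) : bool := [forall i, light M (row i V)].

Lemma count_light_rows M k n :
  (\sum_(V : 'M[F]_(k, n) | light_rows M V) 1 = num_light M n ^ k)%N.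
Proof.
rewrite big_mkcond /num_light [X in (X ^ _)%N]big_mkcond /=.
rewrite -[in RHS](card_ord k) -prod_nat_const.
rewrite -(@sum_prod_rows F nat k n (fun _ s => if light M s then 1%N else 0%N)).
apply: eq_bigr => V _; case: ifP => [/forallP all1|/negbT].
  by rewrite big1 // => i _; rewrite all1.
by rewrite negb_forall => /existsP[i ni]; rewrite (bigD1 i) //= (negPf ni) mul0r.
Qed.

(** After completing [K] to an invertible matrix and substituting, the first [k] rows are light and
    the others free. *)
Lemma count_light_mull M k m n (K : 'M[F]_(k, m)) : row_free K ->
  (\sum_(U : 'M[F]_(m, n) | light_rows M (K *m U)) 1 =
   num_light M n ^ k * p ^ ((m - k) * n))%N.
Proof.
move=> fK; have le_km : (k <= m)%N by rewrite -(eqP fK) rank_leq_col.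
move: K fK; move: (subnKC le_km); move: (m - k)%N => m' em; case: _ / em => K fK.
have gu := compl_unit fK; set g := col_mx _ _ in gu.
have Kg : K *m invmx g = row_mx 1%:M 0.
  have -> : K = row_mx 1%:M 0 *m g by rewrite mul_row_col mul1mx mul0mx addr0.
  by rewrite mulmxK.
have gu' : invmx g \in unitmx by rewrite unitmx_inv.
rewrite (big_mulmxl _ _ _ gu') big_col_mx /=.
under eq_bigr => U1 _ do under eq_bigl => U2 do
  rewrite mulmxA Kg mul_row_col mul1mx mul0mx addr0.
rewrite -count_light_rows big_distrl [RHS]big_mkcond /=; apply: eq_bigr => U1 _.
case: ifP => _; last by rewrite big_pred0_eq.
by rewrite sum1_card mul1n card_mx card_Fp.
Qed.

Section Moment.
Variables (n m M : nat) (lam : 'I_n -> 'I_n -> F -> R).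
Hypothesis vlam : forall j, valid_law eps (lam^~ j).
Hypotheses (n_gt0 : (0 < n)%N) (M_gt0 : (0 < M)%N).
Variable B : 'M[F]_m.

Definition mx_weight (A : 'M[F]_n) : R := \prod_j \prod_i lam i j (A i j).

Definition expect (phi : 'M[F]_n -> R) : R := \sum_A mx_weight A * phi A.

Definition emb_prob (U : 'M[F]_(m, n)) : R :=
  \prod_j col_prob (lam^~ j) U (col j (B *m U)).

Lemma expect_num_emb :
  expect (fun A => (num_emb B A)%:R) = \sum_(U : 'M[F]_(m, n) | row_free U) emb_prob U.
Proof.
rewrite /expect /num_emb.
under eq_bigr => A _ do rewrite natr_sum mulr_sumr.
rewrite (exchange_big_dep (fun U => row_free U)) /=; last by move=> ? ? _ /andP[].
apply: eq_bigr => U fU; rewrite /emb_prob.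
under [RHS]eq_bigr => j _ do rewrite /col_prob big_mkcond.
rewrite -(sum_prod_cols (fun j a => if U *m a == col j (B *m U) then col_weight (lam^~ j) a else 0)).
rewrite big_mkcond; apply: eq_bigr => A _; rewrite /is_emb fU mulr1 /=.
have [UA|/eqP nUA] := eqVneq (U *m A) (B *m U).
  apply: eq_bigr => j _; rewrite -UA (_ : U *m col j A = col j (U *m A)) ?eqxx; last by rewrite !colE mulmxA.
  by apply: eq_bigr => i _; rewrite mxE.
have [j nj] : exists j, U *m col j A != col j (B *m U).
  apply/existsP; apply: contraPT nUA; rewrite negb_exists => /forallP all0.
  case; apply/trmx_inj/row_matrixP => j; apply: trmx_inj; rewrite !tr_row !trmxK.
  by move/negPn/eqP: (all0 j) => <-; rewrite !colE mulmxA.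
by rewrite (bigD1 j) //= (negPf nj) mul0r.
Qed.

Definition all_heavy (U : 'M[F]_(m, n)) : bool :=
  [forall c : 'rV[F]_m, (c != 0) ==> ~~ light M (c *m U)].

Lemma light0 : light M (0 : 'rV[F]_n).
Proof. by rewrite /light /hwt big1 ?mul0n // => i _; rewrite mxE eqxx. Qed.

Lemma heavy_hwt (s : 'rV[F]_n) : ~~ light M s -> (n %/ M <= hwt s)%N.
Proof. by rewrite /light -leqNgt => le; rewrite -(mulnK (hwt s) M_gt0) leq_div2r. Qed.

Lemma all_heavy_row_free U : all_heavy U -> row_free U.
Proof.
move=> /forallP gU; apply/row_free_kerP => c cU; apply/eqP; apply: contraT => c0.
by have := gU c; rewrite c0 cU light0.
Qed.

Let x : R := 2 * P ^+ m * rho ^+ (n %/ M).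

Let x_ge0 : 0 <= x.
Proof. by rewrite !mulr_ge0 ?exprn_ge0 ?rho_ge0 // ltW. Qed.

(** This is [col_prob_split] with an empty [K]: each column has probability [p^(-m)] up to a
    relative error [x]. *)
Lemma emb_prob_all_heavy U : all_heavy U ->
  `|emb_prob U - (P ^+ (m * n))^-1| <= (P ^+ (m * n))^-1 * ((1 + x) ^+ n - 1).
Proof.
move=> /forallP gU; have Pmn : 0 < P ^+ (m * n) by rewrite exprn_gt0.
have -> : emb_prob U - (P ^+ (m * n))^-1 = (P ^+ (m * n))^-1 *
   (\prod_(j < n) (P ^+ m * col_prob (lam^~ j) U (col j (B *m U))) - \prod_(j < n) 1).
  rewrite big_split /= prodr_const card_ord -exprM big1_eq -/(emb_prob U).
  by rewrite mulrBr mulr1 mulKf // gt_eqF.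
rewrite normrM gtr0_norm ?invr_gt0 // ler_pM2l ?invr_gt0 // distrC.
have -> : (1 + x) ^+ n = \prod_(j < n) (1 + x) by rewrite prodr_const card_ord.
apply: prod_dist => [j|j]; first by rewrite normr1.
have := @col_prob_split R p p_prime eps eps_gt0 eps_le1 n (lam^~ j) (vlam j) 0 m 0
  U (col j (B *m U)) (n %/ M).
rewrite !mul0mx expr0 mul1r (col_prob00 (vlam j)) // distrC; apply.
  by rewrite /row_free mxrank0.
move=> c; have [->|c0 _] := eqVneq c 0; first by rewrite sub0mx.
apply: heavy_hwt.
by have := gU c; rewrite c0.
Qed.

Lemma emb_prob_ge0 U : 0 <= emb_prob U.
Proof. by apply: prodr_ge0 => j _; exact: col_prob_ge0 (vlam j). Qed.

(** [K] contains the coefficients of all light combinations. Splitting it off leaves [P ^+ k] times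
    a probability for [K *m U], which a single nonzero combination already bounds by [1 - eps]. *)
Lemma emb_prob_bad k (K : 'M[F]_(k, m)) U : (0 < k)%N -> row_free K -> row_free U ->
  (forall c : 'rV[F]_m, ~~ (c <= K)%MS -> ~~ light M (c *m U)) ->
  emb_prob U <= (P ^+ (m * n))^-1 * (P ^+ k * (1 - eps) + x) ^+ n.
Proof.
move=> k_gt0 fK fU heavy; have Pm : 0 < P ^+ m by rewrite exprn_gt0.
have -> : (P ^+ (m * n))^-1 * (P ^+ k * (1 - eps) + x) ^+ n =
   \prod_(j < n) ((P ^+ m)^-1 * (P ^+ k * (1 - eps) + x)).
  by rewrite prodr_const card_ord exprMn exprVn exprM.
apply: ler_prod => j _; rewrite (col_prob_ge0 _ _ (vlam j)) /=.
rewrite ler_pdivlMl //.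
have := @col_prob_split R p p_prime eps eps_gt0 eps_le1 n (lam^~ j) (vlam j) k m K
  U (col j (B *m U)) (n %/ M) fK (fun c cK => heavy_hwt (heavy c cK)).
set pr := col_prob _ (K *m U) _ => split.
have pr_le : pr <= 1 - eps.
  pose e : 'rV[F]_k := delta_mx 0 (Ordinal k_gt0).
  apply: le_trans (col_prob_mull (vlam j) e _ _) _.
  apply: (col_prob_le _ (vlam j)); rewrite mulmxA !mulmx_free_eq0 //.
  apply/eqP => /matrixP/(_ 0 (Ordinal k_gt0)); rewrite !mxE !eqxx => /eqP.
  by rewrite oner_eq0.
have : P ^+ k * pr <= P ^+ k * (1 - eps) by rewrite ler_wpM2l // exprn_ge0 // ltW.
move: split; rewrite ler_norml -/x; lra.
Qed.

(** Take a largest independent family of coefficient vectors giving light combinations; a light one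
    outside its span would extend it. *)
Lemma maximal_light U : row_free U -> ~~ all_heavy U ->
  exists k (K : 'M[F]_(k, m)), [/\ (0 < k <= m)%N, row_free K, light_rows M (K *m U) &
    forall c : 'rV[F]_m, ~~ (c <= K)%MS -> ~~ light M (c *m U)].
Proof.
move=> fU; rewrite negb_forall => /existsP[c0]; rewrite negb_imply negbK => /andP[c00 lc0].
pose Q k := [exists K : 'M[F]_(k, m), row_free K && light_rows M (K *m U)].
have Q1 : Q 1%N.
  apply/existsP; exists c0; rewrite /row_free rank_rV c00 /=.
  by apply/forallP => i; rewrite rowE [delta_mx _ _]mx11_scalar mxE ord1 !eqxx mul1mx.
have Qle k : Q k -> (k <= m)%N.
  by case/existsP => K /andP[fK _]; rewrite -(eqP fK) rank_leq_col.
have exQ : exists k, Q k by exists 1%N.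
case: (ex_maxnP exQ Qle) => k /[dup] Qk /existsP[K /andP[fK lK]] kmax.
exists k, K; split => //; first by rewrite (kmax 1%N Q1) Qle.
move=> c cK; apply/negP => lc; have : Q (k + 1)%N.
  apply/existsP; exists (col_mx K c); apply/andP; split.
    apply/row_free_kerP => v; rewrite -[v]hsubmxK mul_row_col.
    rewrite [rsubmx v]mx11_scalar mul_scalar_mx; set y := rsubmx v 0 0 => eq0.
    have y0 : y = 0.
      apply/eqP; apply: contraNT cK => y0.
      rewrite -[c](scalerK y0) scalemx_sub //.
      by rewrite (canRL (addKr _) eq0) addr0 -mulNmx submxMl.
    move: eq0; rewrite y0 scale0r addr0 => /eqP; rewrite mulmx_free_eq0 // => /eqP ->.
    by rewrite raddf0 row_mx0.
  apply/forallP => i; rewrite mul_col_mx; case: (split_ordP i) => i' ->.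
    by rewrite rowKu; apply: (forallP lK).
  rewrite rowKd rowE [delta_mx _ _]mx11_scalar mxE ord1 !eqxx mul1mx.
  exact: lc.
by move/kmax; rewrite addn1 ltnn.
Qed.

Variable ell : R.
Hypotheses (ell_ge1 : 1 <= ell) (le_ell : (num_light M n)%:R <= ell).

Let ell_ge0 : 0 <= ell. Proof. exact: le_trans ler01 ell_ge1. Qed.

Let w : R := (P ^+ (m * n))^-1.
Let w_gt0 : 0 < w. Proof. by rewrite invr_gt0 exprn_gt0. Qed.

Lemma sum_uniform : \sum_(U : 'M[F]_(m, n)) w = 1.
Proof.
rewrite sumr_const card_mx card_Fp // -[LHS]mulr_natl natrX divff //.
by rewrite gt_eqF // exprn_gt0.
Qed.

Lemma sum_light_mull k (K : 'M[F]_(k, m)) : row_free K ->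
  \sum_(U : 'M[F]_(m, n) | light_rows M (K *m U)) w <= ell ^+ k / P ^+ (k * n).
Proof.
move=> fK; have le_km : (k <= m)%N by rewrite -(eqP fK) rank_leq_col.
have -> : \sum_(U : 'M[F]_(m, n) | light_rows M (K *m U)) w =
    (\sum_(U : 'M[F]_(m, n) | light_rows M (K *m U)) 1)%N%:R * w.
  by rewrite natr_sum mulr_suml; apply: eq_bigr => U _; rewrite mul1r.
rewrite count_light_mull // natrM !natrX -mulrA.
have -> : P ^+ ((m - k) * n) * w = (P ^+ (k * n))^-1.
  rewrite /w -{2}(subnK le_km) mulnDl exprD.
  by field; rewrite !expf_neq0 // gt_eqF.
rewrite ler_wpM2r // ?invr_ge0 ?exprn_ge0 ?(ltW P_gt0) //.
by rewrite lerXn2r ?nnegrE ?ler0n // (le_trans ler01).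
Qed.

(** Union bound over the nonzero coefficient vectors [c]. *)
Lemma sum_bad_uniform :
  \sum_(U : 'M[F]_(m, n) | ~~ all_heavy U) w <= P ^+ m * (ell / P ^+ n).
Proof.
apply: (@le_trans _ _ (\sum_(c : 'rV[F]_m | c != 0)
    \sum_(U : 'M[F]_(m, n) | light M (c *m U)) w)).
  rewrite (exchange_big_dep xpredT) //= [leRHS](bigID (fun U => ~~ all_heavy U)) /= -[leLHS]addr0.
  apply: lerD; last by apply: sumr_ge0 => U _; apply: sumr_ge0 => c _; exact: ltW.
  apply: ler_sum => U; rewrite negb_forall => /existsP[c]; rewrite negb_imply negbK => lc.
  by rewrite (bigD1 c) //= lerDl; apply: sumr_ge0 => d _; exact: ltW.
apply: (@le_trans _ _ (\sum_(c : 'rV[F]_m | c != 0) (ell / P ^+ n))).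
  apply: ler_sum => c c0; have fc : row_free c by rewrite /row_free rank_rV c0.
  have := sum_light_mull fc; rewrite expr1 mul1n; apply: le_trans.
  rewrite le_eqVlt; apply/orP; left; apply/eqP; apply: eq_bigl => U.
  apply/idP/forallP => [lc i|/(_ 0)]; rewrite rowE [delta_mx _ _]mx11_scalar mxE ?ord1 !eqxx mul1mx //.
have e0 : 0 <= ell / P ^+ n.
  by rewrite divr_ge0 ?(le_trans ler01 ell_ge1) // exprn_ge0 // ltW.
apply: (@le_trans _ _ (\sum_(c : 'rV[F]_m) (ell / P ^+ n))).
  rewrite [leRHS](bigID (fun c => c != 0)) /= lerDl.
  by apply: sumr_ge0 => c _.
by rewrite sumr_const card_mx card_Fp // mul1n -[leLHS]mulr_natl natrX.
Qed.

(** Sum over the possible [K]: [m.+1] bounds the number of sizes and [P ^+ (m * m)] the matrices of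
    each size. The proportion [ell ^+ k / P ^+ (k * n)] of admissible [U] cancels the factor
    [P ^+ k] present in each column. *)
Lemma sum_bad_emb :
  \sum_(U : 'M[F]_(m, n) | row_free U && ~~ all_heavy U) emb_prob U <=
  m.+1%:R * P ^+ (m * m) * (ell ^+ m * (1 - eps + x) ^+ n).
Proof.
have eps0 : 0 <= 1 - eps by rewrite subr_ge0.
pose bd k : R := w * (P ^+ k * (1 - eps) + x) ^+ n.
have bd0 k : 0 <= bd k.
  by rewrite mulr_ge0 ?(ltW w_gt0) // exprn_ge0 // addr_ge0 // mulr_ge0 // exprn_ge0 // ltW.
pose S (k : nat) (U : 'M[F]_(m, n)) : R :=
  \sum_(K : 'M[F]_(k, m) | [&& (0 < k)%N, row_free K & light_rows M (K *m U)]) bd k.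
have S0 k U : 0 <= S k U by apply: sumr_ge0.
apply: (@le_trans _ _ (\sum_(U : 'M[F]_(m, n)) \sum_(k < m.+1) S k U)).
  rewrite [leRHS](bigID (fun U => row_free U && ~~ all_heavy U)) /= -[leLHS]addr0.
  apply: lerD; last by apply: sumr_ge0 => U _; apply: sumr_ge0.
  apply: ler_sum => U /andP[fU nU].
  have [k [K [/andP[k0 km] fK lK heavy]]] := maximal_light fU nU.
  apply: le_trans (emb_prob_bad k0 fK fU heavy) _.
  rewrite (bigD1 (Ordinal (km : (k < m.+1)%N))) //= -[leLHS]addr0.
  apply: lerD; last by apply: sumr_ge0.
  rewrite /S (bigD1 K) /=; last by rewrite k0 fK lK.
  by rewrite lerDl; apply: sumr_ge0.
rewrite exchange_big /= -mulrA -[X in X%:R * _](card_ord m.+1) mulr_natl -sumr_const.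
apply: ler_sum => k _; rewrite /S (exchange_big_dep xpredT) //=.
apply: (@le_trans _ _ (\sum_(K : 'M[F]_(k, m)) ell ^+ m * (1 - eps + x) ^+ n)); last first.
  rewrite sumr_const card_mx card_Fp // -[leLHS]mulr_natl natrX ler_wpM2r //.
    by rewrite mulr_ge0 // exprn_ge0 // addr_ge0.
  by rewrite ler_weXn2l // leq_mul2r -ltnS ltn_ord orbT.
have tot0 : 0 <= ell ^+ m * (1 - eps + x) ^+ n.
  by rewrite mulr_ge0 // exprn_ge0 // addr_ge0.
apply: ler_sum => K _; have [/andP[k0 fK]|nK] := boolP ((0 < k)%N && row_free K); last first.
  by rewrite big_pred0 // => U; rewrite andbA (negPf nK).
under eq_bigl => U do rewrite k0 fK /=.
rewrite /bd -mulr_suml; apply: (@le_trans _ _ (ell ^+ k / P ^+ (k * n) *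
   (P ^+ k * (1 - eps) + x) ^+ n)).
  rewrite ler_wpM2r ?sum_light_mull // exprn_ge0 // addr_ge0 // mulr_ge0 // exprn_ge0 // ltW.
have Pk : 1 <= P ^+ k by rewrite exprn_ege1.
have Pk0 : 0 < P ^+ k by apply: lt_le_trans Pk.
have y0 : 0 <= P ^- k * (P ^+ k * (1 - eps) + x).
  by rewrite mulr_ge0 ?invr_ge0 ?(ltW Pk0) // addr_ge0 // mulr_ge0 // ltW.
rewrite -mulrA exprM -exprVn -exprMn; apply: ler_pM.
- by rewrite exprn_ge0.
- by rewrite exprn_ge0.
- by rewrite ler_weXn2l // -ltnS.
have z0 : 0 <= 1 - eps + x by exact: addr_ge0.
apply: lerXn2r; rewrite ?nnegrE //.
by rewrite mulrDr mulKf ?gt_eqF // lerD2l ler_piMl // invf_le1.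
Qed.

(** The three terms are the error on the heavy [U], the uniform mass of the other [U], and the
    actual contribution of the latter. *)
Lemma moment_bound :
  `|expect (fun A => (num_emb B A)%:R) - 1| <=
  ((1 + x) ^+ n - 1) + P ^+ m * (ell / P ^+ n) +
  m.+1%:R * P ^+ (m * m) * (ell ^+ m * (1 - eps + x) ^+ n).
Proof.
rewrite expect_num_emb (bigID all_heavy) /=.
have -> : \sum_(U | row_free U && all_heavy U) emb_prob U = \sum_(U | all_heavy U) emb_prob U.
  by apply: eq_bigl => U; apply: andb_idl; exact: all_heavy_row_free.
have heavyB : `|\sum_(U | all_heavy U) emb_prob U - \sum_(U | all_heavy U) w| <= (1 + x) ^+ n - 1.
  rewrite -sumrB; apply: le_trans (ler_norm_sum _ _ _) _.
  have e0 : 0 <= (1 + x) ^+ n - 1 by rewrite subr_ge0 exprn_ege1 // lerDl.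
  rewrite -[leRHS]mul1r -[X in X * _]sum_uniform mulr_suml [leRHS](bigID all_heavy) /= -[leLHS]addr0.
  apply: lerD; last by apply: sumr_ge0 => U _; apply: mulr_ge0 => //; exact: ltW.
  by apply: ler_sum => U gU; exact: emb_prob_all_heavy.
have := sum_uniform; rewrite (bigID all_heavy) /= => eq1.
have b0 : 0 <= \sum_(U | row_free U && ~~ all_heavy U) emb_prob U.
  by apply: sumr_ge0 => U _; exact: emb_prob_ge0.
have w0 : 0 <= \sum_(U | ~~ all_heavy U) w by apply: sumr_ge0 => U _; exact: ltW.
have := sum_bad_uniform; have := sum_bad_emb; move: heavyB; rewrite !ler_norml.
lra.
Qed.

End Moment.
End MatrixLaw.

(** * Elementary estimates with explicit thresholds *)

Section Elementary.
Variable R : realType.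
Implicit Types (x y z t : R) (k n : nat).

(** A Bernoulli inequality in product form; for [x < 1] it gives [x ^+ k = O(1 / k)] with an
    explicit constant. *)
Lemma pow_decay x k : 0 <= x <= 1 -> x ^+ k * (1 + k%:R * (1 - x)) <= 1.
Proof.
move=> /andP[x0 x1]; elim: k => [|k IHk]; first by rewrite mul0r addr0 mulr1.
apply: le_trans IHk; rewrite exprSr -mulrA ler_wpM2l ?exprn_ge0 // -natr1.
have k0 : 0 <= k%:R :> R by rewrite ler0n.
rewrite -subr_ge0.
have -> : 1 + k%:R * (1 - x) - x * (1 + (k%:R + 1) * (1 - x)) =
          (k%:R + 1) * (1 - x) ^+ 2 by ring.
by rewrite mulr_ge0 ?sqr_ge0 // addr_ge0.
Qed.

Lemma geometric_small x C t : 0 <= x < 1 -> 0 < t ->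
  exists N, forall k, (N <= k)%N -> C * x ^+ k <= t.
Proof.
move=> /andP[x0 x1] t0; exists (Num.bound (`|C| / ((1 - x) * t))) => k Nk.
have h0 : 0 < (1 - x) * t by rewrite mulr_gt0 // subr_gt0.
have Ck : `|C| <= k%:R * ((1 - x) * t).
  rewrite -ler_pdivrMr //; apply: (@le_trans _ _ (Num.bound (`|C| / ((1 - x) * t)))%:R).
    by rewrite ltW // archi_boundP // divr_ge0 // ltW.
  by rewrite ler_nat.
have [xk0|xk0] := leP (x ^+ k) 0.
  have -> : x ^+ k = 0 by apply/eqP; rewrite eq_le xk0 exprn_ge0.
  by rewrite mulr0 ltW.
apply: (@le_trans _ _ (`|C| * x ^+ k)); first by rewrite ler_wpM2r ?ler_norm // ltW.
apply: (@le_trans _ _ (k%:R * ((1 - x) * t) * x ^+ k)); first by rewrite ler_wpM2r // ltW.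
have := @pow_decay x k; rewrite x0 ltW // => /(_ isT) dec.
have -> : k%:R * ((1 - x) * t) * x ^+ k = t * (x ^+ k * (1 + k%:R * (1 - x)) - x ^+ k) by ring.
by rewrite -[leRHS]mulr1 ler_wpM2l ?ltW //; lra.
Qed.

(** With [x = s^2], one factor [s ^+ k] absorbs the linear growth in [n] and the other still tends
    to zero. *)
Lemma linear_geometric_small x C t M : 0 <= x < 1 -> 0 <= C -> 0 < t -> (0 < M)%N ->
  exists N, forall n, (N <= n)%N -> n%:R * (C * x ^+ (n %/ M)) <= t.
Proof.
move=> /andP[x0 x1] C0 t0 M0; set s := Num.sqrt x.
have s0 : 0 <= s by apply: sqrtr_ge0.
have s1 : s < 1 by rewrite -[ltRHS]sqrtr1 ltr_sqrt.
have h0 : 0 < 1 - s by rewrite subr_gt0.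
have M0' : 0 < M%:R :> R by rewrite ltr0n.
have [N HN] := @geometric_small s (2 * M%:R * C / (1 - s)) t (introT andP (conj s0 s1)) t0.
exists (M * N.+1)%N => n Nn; set k := (n %/ M)%N.
have k1 : (N.+1 <= k)%N by rewrite /k leq_divRL // mulnC.
(* [n < (k + 1) * M <= 2 * M * k], as [k >= 1]. *)
have nk : n%:R <= 2 * M%:R * k%:R :> R.
  rewrite -!natrM ler_nat (leq_trans (ltnW (ltn_ceil n M0))) // -/k.
  by rewrite mulnC -mulnA mulnCA leq_mul2l mul2n -addnn -addn1 leq_add2l (leq_trans _ k1) ?orbT.
apply: le_trans (HN k (ltnW k1)).
have xk : x ^+ k = s ^+ k * s ^+ k by rewrite -exprMn -expr2 sqr_sqrtr.
apply: (@le_trans _ _ (2 * M%:R * k%:R * (C * x ^+ k))).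
  by rewrite ler_wpM2r // mulr_ge0 // exprn_ge0.
rewrite xk; have dec : k%:R * s ^+ k <= (1 - s)^-1.
  rewrite -[(1 - s)^-1]mul1r ler_pdivlMr //.
  have := @pow_decay s k; rewrite s0 ltW // => /(_ isT); apply: le_trans.
  rewrite -subr_ge0 (_ : _ - _ = s ^+ k); last by ring.
  exact: exprn_ge0.
have -> : 2 * M%:R * k%:R * (C * (s ^+ k * s ^+ k)) =
   (2 * M%:R * C * s ^+ k) * (k%:R * s ^+ k) by ring.
have -> : 2 * M%:R * C / (1 - s) * s ^+ k = (2 * M%:R * C * s ^+ k) * (1 - s)^-1 by ring.
by rewrite ler_wpM2l // !mulr_ge0 // ?exprn_ge0 // ltW.
Qed.

Lemma pow1p_le x n : 0 <= x -> n%:R * x <= 2^-1 -> (1 + x) ^+ n - 1 <= 2 * (n%:R * x).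
Proof.
move=> x0 nx; have dec : (1 + x) ^+ n * (1 - n%:R * x) <= 1.
  elim: n {nx} => [|n IHn]; first by rewrite mul0r subr0 mulr1.
  apply: le_trans IHn; rewrite exprSr -mulrA ler_wpM2l ?exprn_ge0 ?addr_ge0 // -natr1.
  have n0 : 0 <= n%:R :> R by rewrite ler0n.
  rewrite -subr_ge0.
  have -> : 1 - n%:R * x - (1 + x) * (1 - (n%:R + 1) * x) = (n%:R + 1) * x ^+ 2 by ring.
  by rewrite mulr_ge0 ?sqr_ge0 // addr_ge0.
set t := n%:R * x in nx dec *; set y := (1 + x) ^+ n in dec *.
have t0 : 0 <= t by rewrite mulr_ge0.
have h0 : 0 < 1 - t by lra.
rewrite lerBlDl -(ler_pM2r h0); apply: (le_trans dec); nra.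
Qed.

(** The constant [3 ^+ m] only affects the size of [eta] in [moment_limit]. *)
Lemma pow1p_le3 x m : 0 <= x <= 1 -> (1 + x) ^+ m <= 1 + 3 ^+ m * x.
Proof.
move=> /andP[x0 x1]; elim: m => [|m IHm]; first by rewrite !expr0 mul1r lerDl.
rewrite exprSr; apply: (@le_trans _ _ ((1 + 3 ^+ m * x) * (1 + x))).
  by rewrite ler_wpM2r // addr_ge0.
have A1 : 1 <= 3 ^+ m :> R by rewrite exprn_ege1 // ler1n.
have A0 : 0 <= 3 ^+ m :> R by apply: le_trans A1.
rewrite exprSr -subr_ge0.
have -> : 1 + 3 ^+ m * 3 * x - (1 + 3 ^+ m * x) * (1 + x) =
          3 ^+ m * x * (1 - x) + x * (3 ^+ m - 1) by ring.
by rewrite addr_ge0 // !mulr_ge0 // subr_ge0.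
Qed.

End Elementary.

Section LightCount.
Variables (R : realType) (p : nat).
Hypothesis p_prime : prime p.
Local Notation F := 'F_p.
Local Notation P := (p%:R : R).

Lemma sum_hwt n (z : R) :
  \sum_(s : 'rV[F]_n) z ^+ hwt s = (1 + (P - 1) * z) ^+ n.
Proof.
have -> : (1 + (P - 1) * z) ^+ n = \prod_(j < n) \sum_(a : 'cV[F]_1) z ^+ (a 0 0 != 0)%R.
  rewrite -[in LHS](card_ord n) -prodr_const; apply: eq_bigr => j _.
  rewrite big_cV1 (bigD1 0) //= mxE eqxx expr0; congr (_ + _).
  rewrite (eq_bigr (fun=> z)) => [|x x0]; last by rewrite mxE eqxx mulr1n x0 expr1.
  have : \sum_(x : F) z = P * z by rewrite sumr_const card_Fp // mulr_natl.
  by rewrite (bigD1 0) //= => /(canRL (addKr _)) ->; ring.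
rewrite -sum_prod_cols; apply: eq_bigr => s _.
rewrite /hwt expr_sum; apply: eq_bigr => j _.
by rewrite mxE.
Qed.

(** Chernoff bound: with [b = 1 + t], every light [s] has [b ^+ n * b ^- (M * hwt s) >= 1]. For [M]
    large these weights sum to at most [(1 + t) ^+ (2 * n)], and [(1 + t)^2 <= 1 + 3 t]. *)
Lemma light_count (t : R) : 0 < t <= 1 ->
  exists2 M, (0 < M)%N & forall n, (num_light p M n)%:R <= (1 + 3 * t) ^+ n.
Proof.
move=> /andP[t0 t1]; have z1 : 0 <= (1 + t)^-1 < 1.
  by rewrite invr_ge0 addr_ge0 ?ltW //= invf_lt1 ?ltrDl // addr_gt0.
have [N HN] := @geometric_small R (1 + t)^-1 (P - 1) t z1 t0.
exists N.+1 => // n; set b := 1 + t; set M := N.+1.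
have b0 : 0 < b by rewrite addr_gt0.
have b1 : 1 <= b by rewrite lerDl ltW.
apply: (@le_trans _ _ (\sum_(s : 'rV[F]_n) b ^+ n * (b ^- M) ^+ hwt s)).
  rewrite /num_light natr_sum big_mkcond /=; apply: ler_sum => s _.
  case: ifP => [ls|_]; last by rewrite mulr_ge0 // ?exprn_ge0 ?invr_ge0 ?exprn_ge0 // ltW.
  rewrite exprVn -exprM ler_pdivlMr ?exprn_gt0 // mul1r ler_weXn2l //.
  by rewrite mulnC ltnW.
rewrite -mulr_sumr sum_hwt -exprMn lerXn2r ?nnegrE //.
- rewrite mulr_ge0 ?(ltW b0) // addr_ge0 // mulr_ge0 ?invr_ge0 ?exprn_ge0 ?(ltW b0) //.
  by rewrite subr_ge0 ler1n prime_gt0.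
- by rewrite addr_ge0 // mulr_ge0 // ltW.
apply: (@le_trans _ _ (b * (1 + t))).
  rewrite ler_pM2l // lerD2l -exprVn; exact: (HN M (leqnSn N)).
rewrite /b; nra.
Qed.

End LightCount.

Lemma moment_limit (R : realType) (p m : nat) (eps : R) (B : 'M['F_p]_m) (t : R) :
  prime p -> 0 < eps -> eps <= 1 -> 0 < t ->
  exists N, forall n, (N <= n)%N -> forall lam : 'I_n -> 'I_n -> 'F_p -> R,
    (forall j, valid_law eps (lam^~ j)) ->
    `|expect lam (fun A => (num_emb B A)%:R) - 1| <= t.
Proof.
move=> p_prime eps_gt0 eps_le1 t0.
have P2 : 2 <= p%:R :> R by rewrite ler_nat prime_gt1.
have P0 : 0 < p%:R :> R by apply: lt_le_trans P2.
have T1 : 1 <= 3 ^+ m :> R by rewrite exprn_ege1 // ler1n.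
(* By [pow1p_le3] this yields [(1 + eta) ^+ m <= 1 + eps / 4], so the choices of [m] light rows lose
   against the factor [1 - eps] per column. *)
pose eta : R := eps / (4 * 3 ^+ m).
have d0 : 0 < 4 * 3 ^+ m :> R by lra.
have eta0 : 0 < eta by rewrite divr_gt0.
have eta1 : eta <= 4^-1.
  by rewrite /eta ler_pdivrMr //; lra.
have eta3 : 0 < eta / 3 <= 1 by apply/andP; split; lra.
have [M M0 HM] := light_count p_prime eta3.
have rho01 : 0 <= rho p eps < 1 by rewrite rho_ge0 rho_lt1.
pose C : R := 2 * p%:R ^+ m.
have C0 : 0 <= C by rewrite mulr_ge0 // exprn_ge0 // ltW.
(* [pow1p_le] doubles [n * x], hence [t / 6] for a final share of [t / 3]. *)
have t6 : 0 < t / 6 by lra.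
have [N1 H1] := linear_geometric_small rho01 C0 t6 M0.
have half : 0 < 2^-1 :> R by lra.
have [N2 H2] := linear_geometric_small rho01 C0 half M0.
have eps2 : 0 < eps / 2 by lra.
have [N3 H3] := linear_geometric_small rho01 C0 eps2 M0.
have t3 : 0 < t / 3 by lra.
(* [(1 + eta) / p <= (1 + 1/4) / 2 = 5/8]. *)
have q1 : 0 <= (5 / 8 : R) < 1 by apply/andP; split; lra.
have [N4 H4] := geometric_small (p%:R ^+ m) q1 t3.
(* [(1 + eps / 4) * (1 - eps / 2) <= 1 - eps / 4]. *)
have q2 : 0 <= 1 - eps / 4 < 1 by apply/andP; split; lra.
have [N5 H5] := geometric_small (m.+1%:R * p%:R ^+ (m * m)) q2 t3.
exists (N1 + N2 + N3 + N4 + N5 + 1)%N => n Nn lam vlam.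
have [[n1 n2 n3] [n4 n5 n0]] : [/\ N1 <= n, N2 <= n & N3 <= n]%N /\
    [/\ N4 <= n, N5 <= n & 0 < n]%N.
  move: Nn; clear; split; split; lia.
pose ell : R := (1 + eta) ^+ n.
have ell1 : 1 <= ell by rewrite exprn_ege1 // lerDl ltW.
have lell : (num_light p M n)%:R <= ell.
  have e3 : 3 * (eta / 3) = eta by field.
  by apply: le_trans (HM n) _; rewrite e3.
have moment := @moment_bound R p p_prime eps eps_gt0 eps_le1 n m M lam vlam n0 M0 B ell ell1 lell.
rewrite -/C in moment; set x := C * rho p eps ^+ (n %/ M) in moment.
have x0 : 0 <= x by rewrite mulr_ge0 // exprn_ge0 // rho_ge0.
have nx1 : n%:R * x <= t / 6 by exact: H1.
have nx2 : n%:R * x <= 2^-1 by exact: H2.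
have nx3 : x <= eps / 2.
  apply: le_trans (H3 n n3).
  by rewrite -/x ler_peMl // ler1n.
have b1 : (1 + x) ^+ n - 1 <= t / 3.
  by apply: le_trans (pow1p_le x0 nx2) _; lra.
have e0 : 0 <= 1 + eta by rewrite addr_ge0 // ltW.
have f0 : 0 <= 1 - eps + x by rewrite addr_ge0 // subr_ge0.
have b2 : p%:R ^+ m * (ell / p%:R ^+ n) <= t / 3.
  apply: le_trans (H4 n n4); apply: ler_wpM2l; first by rewrite exprn_ge0 // ltW.
  rewrite /ell -expr_div_n; apply: lerXn2r; rewrite ?nnegrE.
  - by rewrite divr_ge0 // ltW.
  - by case/andP: q1.
  by rewrite ler_pdivrMr //; lra.
have e1 : (1 + eta) ^+ m <= 1 + eps / 4.
  apply: le_trans (pow1p_le3 m (x := eta) _) _; first by apply/andP; split; lra.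
  rewrite lerD2l /eta le_eqVlt; apply/orP; left; apply/eqP; field.
  by rewrite gt_eqF // (lt_le_trans ltr01 T1).
have b3 : m.+1%:R * p%:R ^+ (m * m) * (ell ^+ m * (1 - eps + x) ^+ n) <= t / 3.
  apply: le_trans (H5 n n5); apply: ler_wpM2l.
    by rewrite mulr_ge0 // exprn_ge0 // ltW.
  rewrite /ell -exprM mulnC exprM -exprMn; apply: lerXn2r; rewrite ?nnegrE.
  - by rewrite mulr_ge0 // exprn_ge0.
  - by case/andP: q2.
  apply: (@le_trans _ _ ((1 + eps / 4) * (1 - eps / 2))).
    apply: ler_pM => //; first exact: exprn_ge0.
    by move: nx3; move: (x) => y hy; lra.
  rewrite -subr_ge0 (_ : _ - _ = eps ^+ 2 / 8); last by field.
  by rewrite divr_ge0 // sqr_ge0.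
apply: le_trans (_ : t / 3 + t / 3 + t / 3 <= t); last by lra.
by move/le_trans: (moment); apply; rewrite !lerD.
Qed.


(** * The limiting distribution *)

Section Euler.
Variables (R : realType) (q : R).
Hypothesis q_ge2 : 2 <= q.

Let q_gt1 : 1 < q. Proof. by move: q_ge2; lra. Qed.
Let q_gt0 : 0 < q. Proof. by move: q_ge2; lra. Qed.

Definition euler_prod N : R := \prod_(k < N) (1 - q ^- k.+1).

Definition euler_sum K (u : R) : R := \sum_(k < K.+1) alpha q k * u ^+ k.

Lemma qfact_ge1 k : 1 <= qfact q k.
Proof.
elim: k => [|k IHk]; first by rewrite /qfact big_ord0.
have q2 : q <= q ^+ k.+1 by rewrite exprS ler_peMr ?exprn_ege1 // ltW.
by rewrite qfactS -[leLHS]mulr1 ler_pM //; move: q_ge2; lra.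
Qed.

Lemma qfact_ge k : k%:R <= qfact q k.
Proof.
case: k => [|k]; first by rewrite (le_trans ler01) ?qfact_ge1.
rewrite qfactS; have b : k.+2%:R <= q ^+ k.+1.
  elim: k => [|k IHk]; first by rewrite expr1.
  rewrite exprS -[k.+3]addn1 natrD.
  have k0 : 0 <= k%:R :> R by rewrite ler0n.
  have : 2 * k.+2%:R <= q * q ^+ k.+1 by rewrite ler_pM.
  by move=> h; apply: le_trans h; rewrite -!natr1; lra.
have b' : k.+1%:R <= q ^+ k.+1 - 1 by rewrite lerBrDr natr1.
by rewrite -[leLHS]mul1r ler_pM // qfact_ge1.
Qed.

(* Truncated form of the functional equation of sum_k alpha_k u^k, which yields its
   product formula by iterating u -> u / q. *)
Lemma euler_sum_step K u :
  euler_sum K (q * u) = (1 - u) * euler_sum K u + alpha q K * u ^+ K.+1.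
Proof.
rewrite mulrBl mul1r /euler_sum; elim: K => [|K IHK].
  by rewrite !big_ord_recr !big_ord0 /= !add0r alpha0 !expr0; ring.
rewrite big_ord_recr IHK /= [in RHS]big_ord_recr /=.
have -> : alpha q K.+1 * (q * u) ^+ K.+1 =
          alpha q K.+1 * u ^+ K.+1 - alpha q K * u ^+ K.+1.
  have Q1 : q ^+ K.+1 - 1 != 0 by rewrite gt_eqF // subr_gt0 expq_gt1.
  have f0 := qfact_neq0 q_gt1 K.
  rewrite /alpha qfactS exprMn [(-1) ^+ _]exprS; move: Q1 f0.
  move: (q ^+ K.+1) (u ^+ K.+1) (qfact q K) ((-1) ^+ K) => Q V c s Q1 c0.
  by field; rewrite c0 Q1.
rewrite mulrDr; set S := \sum_(k < K.+1) _; rewrite !exprS; ring.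
Qed.

Lemma alpha_le1 k : `|alpha q k| <= 1.
Proof. by rewrite alpha_norm // invf_le1 ?qfact_gt0 ?qfact_ge1. Qed.

Lemma euler_sum_near1 K u : 0 <= u <= 1 -> `|euler_sum K u - 1| <= K%:R * u.
Proof.
move=> /andP[u0 u1]; rewrite /euler_sum big_ord_recl /= alpha0 mul1r expr0 addrC addKr.
apply: le_trans (ler_norm_sum _ _ _) _.
rewrite -[K in K%:R](card_ord K) mulr_natl -sumr_const; apply: ler_sum => k _.
rewrite normrM -[leRHS]mul1r ler_pM // ?alpha_le1 // ger0_norm ?exprn_ge0 //.
by rewrite /bump /= add1n exprS ler_piMr // exprn_ile1.
Qed.

Lemma euler_factor k : 0 <= 1 - q ^- k.+1 <= 1.
Proof.
have h : 0 < q ^- k.+1 by rewrite invr_gt0 exprn_gt0.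
have : q ^- k.+1 <= 1 by rewrite invf_le1 ?exprn_gt0 // exprn_ege1 // ltW.
by move=> h'; apply/andP; split; lra.
Qed.

Lemma euler_prod_bound N : 0 <= euler_prod N <= 1.
Proof.
rewrite /euler_prod prodr_ge0 /=; last by move=> k _; case/andP: (euler_factor k).
apply: (@le_trans _ _ (\prod_(k < N) 1)); last by rewrite big1.
by apply: ler_prod => k _; exact: euler_factor.
Qed.

(** Iterates [euler_sum_step] from [u = 1] downwards; the step to [u = h] costs at most
    [h / qfact q K]. As [q >= 2], the costs add up to at most [1 - q ^- N] times [1 / qfact q K], a
    form that closes the induction. *)
Lemma euler_approx K N :
  `|euler_sum K 1 - euler_prod N * euler_sum K (q ^- N)| <= (qfact q K)^-1 * (1 - q ^- N).
Proof.
elim: N => [|N IHN].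
  by rewrite expr0 invr1 /euler_prod big_ord0 mul1r subrr normr0 subrr mulr0.
have qN : q ^- N = q * q ^- N.+1 by rewrite exprS invfM mulrA divff ?mul1r ?gt_eqF.
have h0 : 0 < q ^- N.+1 by rewrite invr_gt0 exprn_gt0.
have h1 : q ^- N.+1 <= 1 by rewrite invf_le1 ?exprn_gt0 // exprn_ege1 // ltW.
move: IHN; rewrite qN euler_sum_step; set h := q ^- N.+1 in h0 h1 *.
have -> : euler_prod N.+1 = euler_prod N * (1 - h) by rewrite /euler_prod big_ord_recr.
have /andP[P0 P1] := euler_prod_bound N; set p := euler_prod N in P0 P1 *.
have ha : `|p * (alpha q K * h ^+ K.+1)| <= (qfact q K)^-1 * h.
  rewrite normrM -[leRHS]mul1r ler_pM //; first by rewrite ger0_norm.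
  rewrite normrM alpha_norm // ler_wpM2l ?invr_ge0 ?(ltW (qfact_gt0 q_gt1 _)) //.
  rewrite ger0_norm ?exprn_ge0 ?(ltW h0) // exprS ler_piMr ?(ltW h0) //.
  by rewrite exprn_ile1 // ltW.
move=> IHN.
have -> : euler_sum K 1 - p * (1 - h) * euler_sum K h =
    (euler_sum K 1 - p * ((1 - h) * euler_sum K h + alpha q K * h ^+ K.+1)) +
    p * (alpha q K * h ^+ K.+1) by ring.
apply: le_trans (ler_normD _ _) _; apply: le_trans (lerD IHN ha) _.
rewrite -mulrDr ler_wpM2l ?invr_ge0 ?(ltW (qfact_gt0 q_gt1 _)) //.
have : 2 * h <= q * h by rewrite ler_pM2r.
lra.
Qed.

Lemma euler_dist K N :
  `|euler_sum K 1 - euler_prod N| <= (qfact q K)^-1 + K%:R * q ^- N.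
Proof.
have h0 : 0 < q ^- N by rewrite invr_gt0 exprn_gt0.
have h1 : q ^- N <= 1 by rewrite invf_le1 ?exprn_gt0 // exprn_ege1 // ltW.
have h01 : 0 <= q ^- N <= 1 by rewrite h1 ltW.
have -> : euler_sum K 1 - euler_prod N =
    (euler_sum K 1 - euler_prod N * euler_sum K (q ^- N)) +
    euler_prod N * (euler_sum K (q ^- N) - 1) by ring.
apply: le_trans (ler_normD _ _) _; apply: lerD.
  apply: le_trans (euler_approx K N) _.
  by rewrite ler_piMr ?invr_ge0 ?(ltW (qfact_gt0 q_gt1 _)) // lerBlDr lerDl ltW.
have /andP[P0 P1] := euler_prod_bound N.
rewrite normrM -[leRHS]mul1r ler_pM //; first by rewrite ger0_norm.
exact: euler_sum_near1.
Qed.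

Lemma euler_sum1 K : euler_sum K 1 = \sum_(k < K.+1) alpha q k.
Proof. by apply: eq_bigr => k _; rewrite expr1n mulr1. Qed.

End Euler.

Section Nu.
Variables (R : realType) (p : nat) (f : {poly 'F_p}).
Hypothesis p_prime : prime p.
Hypothesis f_gt1 : (1 < size f)%N.
Let q : R := (p ^ (size f).-1)%:R.

Let q_ge2 : 2 <= q.
Proof.
rewrite ler_nat; have d0 : (0 < (size f).-1)%N by case: (size f) f_gt1 => [|[]].
by rewrite -(prednK d0) expnS (leq_trans (prime_gt1 p_prime)) // leq_pmulr // expn_gt0 prime_gt0.
Qed.

Lemma nu_factorE j N : nu_factor R f j N = \prod_(j.+1 <= k < N) (1 - q ^- k).
Proof.
by apply: eq_bigr => k _; rewrite /q natrX -exprM mulnC.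
Qed.

Lemma nu_factor0 N : nu_factor R f 0 N.+1 = euler_prod q N.
Proof. by rewrite nu_factorE big_add1 big_mkord. Qed.

Lemma gam_euler j : gam q j * euler_prod q j = q ^- j.
Proof.
have q1 : 1 < q by move: q_ge2; lra.
have q0 : 0 < q by move: q_ge2; lra.
have -> : euler_prod q j = qfact q j / q ^+ 'C(j.+1, 2).
  rewrite /euler_prod /qfact; elim: j => [|j IHj]; first by rewrite !big_ord0 divr1.
  rewrite !big_ord_recr /= IHj [in RHS]binS bin1 exprD.
  by field; rewrite !expf_neq0 // gt_eqF.
rewrite /gam binS bin1 exprD; field.
by rewrite qfact_neq0 // !expf_neq0 // gt_eqF.
Qed.

(** By [gam_euler], the factors [k <= j] missing from the tail product turn [q ^- j] into [gam q j],
    and the remaining limit does not depend on [j]. *)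
Lemma nuE j : nu R f j = gam q j * limn (nu_factor R f 0).
Proof.
have q0 : 0 < q by move: q_ge2; lra.
rewrite /nu; have -> : p%:R ^- (j * (size f).-1) = q ^- j by rewrite /q natrX -exprM mulnC.
rewrite -gam_euler -mulrA; congr (_ * _); apply/esym/cvg_lim => //.
have : (euler_prod q j * nu_factor R f j N @[N --> \oo] -->
        euler_prod q j * limn (nu_factor R f j))%classic.
  by apply: cvgMr; exact: is_cvg_nu_factor.
apply: cvg_trans; apply: near_eq_cvg; near=> N.
rewrite !nu_factorE [RHS](big_cat_nat (n := j.+1)) //=; first last.
  by near: N; exists j.+1.
by congr (_ * _); rewrite /euler_prod big_add1 /= big_mkord.
Unshelve. all: by end_near. Qed.

Lemma lim_nu_factor_dist K :
  `|limn (nu_factor R f 0) - \sum_(k < K.+1) alpha q k| <= (qfact q K)^-1.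
Proof.
have q1 : 1 < q by move: q_ge2; lra.
rewrite -(euler_sum1 q K).
pose g N := `|nu_factor R f 0 N.+1 - euler_sum q K 1| - K%:R * q ^- N.
have cg : (g N @[N --> \oo] --> `|limn (nu_factor R f 0) - euler_sum q K 1|)%classic.
  rewrite -[X in (_ --> X)%classic]subr0; apply: cvgB.
    apply: cvg_norm; apply: cvgB; last exact: cvg_cst.
    by rewrite cvg_shiftS; exact: is_cvg_nu_factor.
  rewrite -[X in (_ --> X)%classic](mulr0 K%:R); apply: cvgMr.
  apply: (@cvg_trans _ (geometric 1 q^-1 @ \oo)%classic).
    by apply: near_eq_cvg; near=> N; rewrite /geometric /= mul1r exprVn.
  have q0 : 0 < q by move: q1; lra.
  by apply: cvg_geometric; rewrite ger0_norm ?invr_ge0 ?(ltW q0) // invf_lt1.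
rewrite -(cvg_lim _ cg) //; apply: limr_le; first by apply/cvg_ex; eexists; exact: cg.
near=> N; rewrite /g nu_factor0 lerBlDr distrC; exact: euler_dist.
Unshelve. all: by end_near. Qed.

Lemma lim_nu_factor_le1 : `|limn (nu_factor R f 0)| <= 1.
Proof.
have cg : (nu_factor R f 0 N.+1 @[N --> \oo] --> limn (nu_factor R f 0))%classic.
  by rewrite cvg_shiftS; exact: is_cvg_nu_factor.
have cg' : (`|nu_factor R f 0 N.+1| @[N --> \oo] --> `|limn (nu_factor R f 0)|)%classic by exact: cvg_norm.
rewrite -(cvg_lim _ cg') //; apply: limr_le; first by apply/cvg_ex; eexists; exact: cg'.
near=> N; rewrite nu_factor0; have /andP[P0 P1] := euler_prod_bound q_ge2 N.
by rewrite ger0_norm.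
Unshelve. all: by end_near. Qed.

End Nu.

(** * From the moments to the limiting probability of a type *)

Section Uniform.
Variables (R : realType) (p : nat) (eps : R).
Hypotheses (p_prime : prime p) (eps_gt0 : 0 < eps) (eps_le1 : eps <= 1).
Local Notation F := 'F_p.

(* The convergence is uniform in the law of the matrix. *)
Definition uconv (phi : forall n, 'M[F]_n -> R) (l : R) : Prop :=
  forall t, 0 < t -> exists N, forall n, (N <= n)%N ->
    forall lam : 'I_n -> 'I_n -> F -> R, (forall j, valid_law eps (lam^~ j)) ->
    `|expect lam (phi n) - l| <= t.

Lemma expectD n (lam : 'I_n -> 'I_n -> F -> R) phi psi :
  expect lam (fun A => phi A + psi A) = expect lam phi + expect lam psi.
Proof. by rewrite /expect -big_split; apply: eq_bigr => A _; rewrite mulrDr. Qed.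

Lemma expectZ n (lam : 'I_n -> 'I_n -> F -> R) c phi :
  expect lam (fun A => c * phi A) = c * expect lam phi.
Proof. by rewrite /expect mulr_sumr; apply: eq_bigr => A _; rewrite mulrCA. Qed.

Lemma expect_dist n (lam : 'I_n -> 'I_n -> F -> R) phi psi chi omega :
  (forall j, valid_law eps (lam^~ j)) ->
  (forall A, `|phi A - psi A| <= chi A - omega A) ->
  `|expect lam phi - expect lam psi| <= expect lam chi - expect lam omega.
Proof.
move=> vlam le; rewrite /expect -!sumrB; apply: le_trans (ler_norm_sum _ _ _) _.
apply: ler_sum => A _; rewrite -!mulrBr normrM.
have w0 : 0 <= mx_weight lam A.
  by apply: prodr_ge0 => j _; apply: prodr_ge0 => i _; case: (vlam j).
by rewrite ger0_norm // ler_wpM2l.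
Qed.

Lemma uconvD phi psi l l' : uconv phi l -> uconv psi l' ->
  uconv (fun n A => phi n A + psi n A) (l + l').
Proof.
move=> cphi cpsi t t0; have t2 : 0 < t / 2 by rewrite divr_gt0.
have [N1 H1] := cphi _ t2; have [N2 H2] := cpsi _ t2.
exists (maxn N1 N2) => n; rewrite geq_max => /andP[n1 n2] lam vlam.
have := H1 n n1 lam vlam; have := H2 n n2 lam vlam; rewrite expectD !ler_norml.
lra.
Qed.

Lemma uconvZ c phi l : uconv phi l -> uconv (fun n A => c * phi n A) (c * l).
Proof.
move=> cphi t t0; have c0 : 0 < `|c| + 1 by rewrite ltr_wpDl.
have [N H] := cphi (t / (`|c| + 1)) (divr_gt0 t0 c0).
exists N => n Nn lam vlam; rewrite expectZ -mulrBr normrM.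
apply: (@le_trans _ _ ((`|c| + 1) * `|expect lam (phi n) - l|)).
  by rewrite ler_wpM2r // lerDl.
by rewrite mulrC -ler_pdivlMr //; exact: H.
Qed.

Lemma uconv_ext phi psi l : uconv phi l -> (forall n A, phi n A = psi n A) -> uconv psi l.
Proof.
move=> cphi e t /cphi[N H]; exists N => n Nn lam vlam.
by rewrite (_ : psi n = phi n) ?H //; apply/funext => A; rewrite e.
Qed.

Lemma uconv0 : uconv (fun n A => 0) 0.
Proof.
move=> t t0; exists 0%N => n _ lam vlam.
by rewrite /expect big1 ?subrr ?normr0 ?ltW // => A _; rewrite mulr0.
Qed.

Lemma uconv_sum (I : Type) (s : seq I) (Q : pred I) (phi : I -> forall n, 'M[F]_n -> R)
    (l : I -> R) : (forall i, Q i -> uconv (phi i) (l i)) ->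
  uconv (fun n A => \sum_(i <- s | Q i) phi i n A) (\sum_(i <- s | Q i) l i).
Proof.
move=> cphi; elim: s => [|i s IHs].
  by rewrite big_nil; apply: uconv_ext uconv0 _ => n A; rewrite big_nil.
rewrite big_cons; case: ifP => Qi.
  by apply: uconv_ext (uconvD (cphi i Qi) IHs) _ => n A; rewrite big_cons Qi.
by apply: uconv_ext IHs _ => n A; rewrite big_cons Qi.
Qed.

Lemma uconv_num_emb m (B : 'M[F]_m) : uconv (fun n A => (num_emb B A)%:R) 1.
Proof. by move=> t t0; exact: moment_limit. Qed.

Section TypeLimit.
Variables (r : nat) (f : 'I_r -> {poly F}) (j : 'I_r -> nat).
Hypotheses (f_inj : injective f) (f_mi : forall i, monic_irr (f i)).
Local Notation m := (type_dim f j).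
Local Notation G := (type_poly f j).

Let num_type : R := (\sum_(B : 'M[F]_m | char_poly B == G) 1)%N%:R.

Lemma uconv_chain_count k :
  uconv (fun n A => (chain_count f j k A)%:R) (num_type * (#|F| ^ (cdim (block_seq f k) * m))%:R).
Proof.
have -> : num_type * (#|F| ^ (cdim (block_seq f k) * m))%:R =
    \sum_(B : 'M[F]_m | char_poly B == G)
      \sum_(C : 'M[F]_(cdim (block_seq f k), m)) 1.
  by rewrite /num_type natr_sum mulr_suml; apply: eq_bigr => B _;
    rewrite sumr_const card_mx mul1r.
apply: uconv_ext (uconv_sum (phi := fun B n A => \sum_(C : 'M[F]_(cdim (block_seq f k), m))
    (num_emb (block_mx B 0 C (cmx (block_seq f k))) A)%:R) _ _) _ => [B _|n A].
  by apply: uconv_sum => C _; exact: uconv_num_emb.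
by rewrite /chain_count natr_sum; apply: eq_bigr => B _; rewrite natr_sum.
Qed.

(** The number of blocks [C], each with limiting moment 1, cancels the normalization in [chain_sum];
    the sum over families [k] then factors over [i]. *)
Lemma uconv_chain_sum K b :
  uconv (fun n A => chain_sum f j K b A) (num_type * \prod_i \sum_(k < K) b i k).
Proof.
have Q0 l : (#|F| ^ l)%:R != 0 :> R.
  by rewrite pnatr_eq0 expn_eq0 negb_and -lt0n (ltnW (card_finNzRing_gt1 _)).
rewrite bigA_distr_bigA mulr_sumr /chain_sum.
apply: uconv_sum => k _; set kn := fun i => nat_of_ord (k i).
have := uconvZ ((\prod_i b i (k i)) / (#|F| ^ (cdim (block_seq f kn) * m))%:R)
  (uconv_chain_count kn).
rewrite [X in uconv _ X](_ : _ = num_type * \prod_i b i (k i)); last first.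
  by rewrite mulrC -!mulrA [X in _ * X]mulrC -mulrA mulVf // mulr1.
by move/uconv_ext; apply => n A; rewrite -mulrA [_^-1 * _]mulrC.
Qed.

Definition euler_lim i : R := limn (nu_factor R (f i) 0).

Let q i : R := (residue_card (f i))%:R.

Lemma residue_cardE i : residue_card (f i) = (p ^ (size (f i)).-1)%N.
Proof. by rewrite /residue_card card_Fp. Qed.

Lemma residue_ge2 i : 2 <= q i.
Proof. by rewrite ler_nat residue_card_gt1. Qed.

Lemma euler_lim_dist i K :
  `|euler_lim i - \sum_(k < K.+1) alpha (q i) k| <= (qfact (q i) K)^-1.
Proof.
rewrite /q residue_cardE; apply: lim_nu_factor_dist => //.
by case: (f_mi i) => _ [].
Qed.

Lemma prod_qfact_small t : 0 < t -> exists K, forall L, (K <= L)%N ->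
  \prod_(i < r) (1 + (qfact (q i) L)^-1) - 1 <= t.
Proof.
(* The first summand makes [2 r / L] at most [t], the second gives the hypothesis [r / L <= 1/2] of
   [pow1p_le], and the last keeps [L] positive. *)
move=> t0; pose K := (Num.bound (2 * r%:R / t) + 2 * r + 1)%N; exists K => L KL.
have L0 : 0 < L%:R :> R by rewrite ltr0n (leq_trans _ KL) // /K addn1.
apply: (@le_trans _ _ ((1 + L%:R^-1) ^+ r - 1)).
  rewrite lerD2r -[r in X in _ <= X](card_ord r) -prodr_const; apply: ler_prod => i _.
  have q1 : 1 < q i by have := residue_ge2 i; lra.
  rewrite addr_ge0 ?invr_ge0 ?(ltW (qfact_gt0 q1 _)) //= lerD2l lef_pV2 ?posrE ?qfact_gt0 //.
  exact: qfact_ge (residue_ge2 i) L.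
have rL : 2 * r%:R <= L%:R :> R.
  by rewrite -natrM ler_nat (leq_trans _ KL) // /K -addnA addnCA leq_addr.
apply: le_trans (pow1p_le _ _) _; first by rewrite invr_ge0 ltW.
  by rewrite ler_pdivrMr // ; lra.
rewrite mulrA ler_pdivrMr // [t * _]mulrC -ler_pdivrMr //.
apply: (@le_trans _ _ (Num.bound (2 * r%:R / t))%:R).
  by rewrite ltW // archi_boundP // divr_ge0 ?mulr_ge0 // ltW.
by rewrite ler_nat (leq_trans _ KL) // /K -addnA leq_addr.
Qed.

Lemma uconv_of_type :
  uconv (fun n A => (of_type f j A)%:R) (char_count R m G * \prod_i euler_lim i).
Proof.
move=> t t0; set g : R := (gl_order F m)%:R.
have g0 : 0 < g by rewrite ltr0n gl_order_gt0.
have b0 : 0 <= num_type by rewrite ler0n.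
(* The budget [g * t] is spent as [g * t / 4] twice on the series tails and [g * t / 6] three times
   on the moments; [num_type + 1] avoids a division by zero. *)
have tb : 0 < g * t / (4 * (num_type + 1)) by rewrite divr_gt0 ?mulr_gt0 //; lra.
have [K HK] := prod_qfact_small tb.
pose D := \prod_(i < r) (1 + (qfact (q i) K)^-1) - 1.
have bD : num_type * D <= g * t / 4.
  have : num_type * D <= (num_type + 1) * (g * t / (4 * (num_type + 1))).
    have D0 : 0 <= D.
      rewrite /D subr_ge0; apply: (@le_trans _ _ (\prod_(i < r) 1)); first by rewrite big1.
      apply: ler_prod => i _; rewrite ler01 lerDl invr_ge0 ltW // qfact_gt0 //.
      by have := residue_ge2 i; lra.
    apply: (@le_trans _ _ ((num_type + 1) * D)); first by rewrite ler_wpM2r // lerDl.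
    by rewrite ler_wpM2l ?HK // addr_ge0.
  by rewrite (_ : _ * (_ / _) = g * t / 4) //; field; lra.
have t6 : 0 < g * t / 6 by rewrite divr_gt0 // mulr_gt0.
have [N1 H1] := uconv_chain_sum K.+1 (mobius_coef R f) t6.
have [N2 H2] := uconv_chain_sum K.+2 (error_coef R f K) t6.
have [N3 H3] := uconv_chain_sum 1 (@unit_coef R r) t6.
exists (maxn (maxn N1 N2) (maxn N3 m)) => n.
rewrite !geq_max => /andP[/andP[n1 n2] /andP[n3 nm]] lam vlam.
have := H1 n n1 lam vlam; have := H2 n n2 lam vlam; have := H3 n n3 lam vlam.
set X1 := expect lam (fun A => chain_sum f j K.+1 (mobius_coef R f) A).
set X2 := expect lam (fun A => chain_sum f j K.+2 (error_coef R f K) A).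
set X3 := expect lam (fun A => chain_sum f j 1 (@unit_coef R r) A).
have -> : \prod_(i < r) \sum_(k < 1) @unit_coef R r i k = 1.
  by rewrite big1 // => i _; rewrite big_ord1.
rewrite mulr1 => h3.
have -> : \prod_i \sum_(k < K.+2) error_coef R f K i k =
    \prod_i (1 + (qfact (q i) K.+1)^-1).
  apply: eq_bigr => i _; rewrite big_ord_recl big_ord_recr /= big1 => [|k _].
    by rewrite /error_coef /= eqxx add0r.
  by rewrite /error_coef /= /bump /= add1n eqSS ltn_eqF.
move=> h2; set S := \prod_i \sum_(k < K.+1) _ => h1.
have SD : `|\prod_i euler_lim i - S| <= D.
  apply: prod_dist => i; last exact: euler_lim_dist.
  by apply: lim_nu_factor_le1 => //; case: (f_mi i) => _ [].
have D1 : \prod_(i < r) (1 + (qfact (q i) K.+1)^-1) - 1 <= D.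
  rewrite lerD2r; apply: ler_prod => i _.
  have q1 : 1 < q i by have := residue_ge2 i; lra.
  have qf0 L : 0 < qfact (q i) L by exact: qfact_gt0.
  rewrite addr_ge0 ?invr_ge0 ?(ltW (qf0 _)) //= lerD2l lef_pV2 ?posrE //.
  rewrite qfactS ler_peMr ?(ltW (qf0 _)) //.
  have : q i <= q i ^+ K.+1 by rewrite exprS ler_peMr ?exprn_ege1 // ltW // (lt_trans ltr01).
  by have := residue_ge2 i; lra.
have bS : `|num_type * \prod_i euler_lim i - num_type * S| <= num_type * D.
  by rewrite -mulrBr normrM ger0_norm // ler_wpM2l.
have bT : num_type * (\prod_(i < r) (1 + (qfact (q i) K.+1)^-1)) - num_type <= num_type * D.
  by rewrite -[X in _ - X]mulr1 -mulrBr ler_wpM2l.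
set e := expect lam _.
have h4 : `|g * e - X1| <= X2 - X3.
  rewrite -expectZ; apply: expect_dist => // A.
  exact: of_type_approx.
have e0 : e - char_count R m G * \prod_i euler_lim i =
    (g * e - num_type * \prod_i euler_lim i) / g.
  by rewrite /char_count -/num_type -/g; field; rewrite gt_eqF.
rewrite e0 normrM normfV (gtr0_norm g0) ler_pdivrMr // mulrC.
move: h1 h2 h3 h4 bS bT bD; rewrite !ler_norml; lra.
Qed.

End TypeLimit.
End Uniform.

(** Coprimality of powers of distinct [f i] turns the separate divisibilities into divisibility by
    [type_poly]; an excess factor [f i] survives in the cofactor. *)
Lemma multiplicity_type (F : finFieldType) (r : nat) (f : 'I_r -> {poly F})
    (j : 'I_r -> nat) n (A : 'M[F]_n) :
  injective f -> (forall i, monic_irr (f i)) ->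
  (forall i, multiplicity (f i) (char_poly A) = j i) <-> of_type f j A.
Proof.
move=> f_inj f_mi; set c := char_poly A.
have c0 : c != 0 by rewrite monic_neq0 // char_poly_monic.
have f_gt1 i : (1 < size (f i))%N by case: (f_mi i) => _ [].
have G0 : type_poly f j != 0 by rewrite monic_neq0 // type_monic.
have cop i (P : pred 'I_r) : ~~ P i -> coprimep (f i) (\prod_(k < r | P k) f k ^+ j k).
  move=> nPi; elim/big_ind: _ => [|x y cx cy|k Pk]; rewrite ?coprimep1 ?coprimepMr ?cx //.
  rewrite coprimep_expr //; apply: monic_irr_coprime => //.
  by apply: contraNneq nPi => /f_inj ->.
split=> [mult|/andP[Gc /forallP nf] i].
  have Gc : type_poly f j %| c.
    rewrite /type_poly; elim: (index_enum 'I_r) (index_enum_uniq 'I_r) => [_|i s IHs /= /andP[is_ us]].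
      by rewrite big_nil dvd1p.
    rewrite big_cons Gauss_dvdp; first by rewrite IHs // multiplicityP // mult leqnn.
    rewrite coprimep_expl // big_seq; elim/big_ind: _ => [|x y cx cy|k ks];
      rewrite ?coprimep1 ?coprimepMr ?cx //.
    rewrite coprimep_expr //; apply: monic_irr_coprime => //.
    by apply: contraNneq is_ => /f_inj ->.
  apply/andP; split=> //; apply/forallP => i; apply/negP => fi.
  have : f i ^+ (j i).+1 %| c.
    rewrite -(divpK Gc) exprS dvdp_mul // /type_poly (bigD1 i) //=.
    by rewrite dvdp_mulr.
  by rewrite multiplicityP // mult ltnn.
apply/eqP; rewrite eqn_leq; apply/andP; split; last first.
  by rewrite -multiplicityP // (dvdp_trans _ Gc) // /type_poly (bigD1 i) //= dvdp_mulr.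
rewrite leqNgt -multiplicityP //; apply/negP.
have := nf i; rewrite -/c => nfi; rewrite -[c](divpK Gc); move: nfi.
move: (c %/ type_poly f j) => H nfi; rewrite /type_poly (bigD1 i) //= mulrCA exprSr.
rewrite dvdp_mul2l; last by rewrite expf_neq0 // monic_neq0 // (proj1 (f_mi i)).
by rewrite Gauss_dvdpl; [exact/negP | apply: cop; rewrite eqxx].
Qed.

Local Open Scope classical_set_scope.
Local Open Scope ring_scope.

(** * From the probability space to finite sums over matrices *)

Section FiniteLaw.
Variables (R : realType) (d : measure_display) (T : measurableType d) (P : probability T R).

Lemma prob_finite (V : finType) (Y : T -> V) (Q : pred V) :
  (forall a, measurable (Y @^-1` [set a])) ->
  P (Y @^-1` [set a | Q a]) =
  (\sum_(a | Q a) fine (P (Y @^-1` [set a])))%:E.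
Proof.
move=> mY.
have -> : (Y @^-1` [set a | Q a] = \bigcup_(a in [set a | Q a]) (Y @^-1` [set a])).
  apply/seteqP; split => w /=; first by move=> Qw; exists (Y w).
  by case=> a /= Qa ->.
rewrite measure_fin_bigcup //; first last.
- by move=> a b _ _ [w [/= <- <-]].
- exact: finite_finset.
rewrite -sumEFin.
have -> : [set a | Q a] = [set` [seq a <- index_enum V | Q a]].
  by apply/seteqP; split => a /=; rewrite mem_filter mem_index_enum andbT.
rewrite -fsbig_seq ?filter_uniq ?index_enum_uniq // big_filter.
apply: eq_bigr => a _; rewrite fineK //; exact: fin_num_measure.
Qed.

Variables (p n : nat) (A : T -> 'M['F_p]_n) (eps : R).
Hypothesis p_prime : prime p.
Hypothesis A_rv : forall i j : 'I_n, random_element (fun w => A w i j).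
Hypothesis A_balanced : forall i j : 'I_n, balanced P eps (fun w => A w i j).
Hypothesis A_indep : mutually_independent P (fun (ij : 'I_n * 'I_n) w => A w ij.1 ij.2).

Definition entry_law (i j : 'I_n) (a : 'F_p) : R :=
  fine (P ((fun w => A w i j) @^-1` [set a])).

Lemma entry_law_valid j : valid_law eps (entry_law^~ j).
Proof.
split=> [i a|i|i a].
- by apply: fine_ge0; exact: measure_ge0.
- have := @prob_finite _ (fun w => A w i j) xpredT (fun a => A_rv i j [set a]).
  rewrite (_ : _ @^-1` _ = setT) ?probability_setT; last by apply/seteqP.
  by case=> <-.
rewrite -lee_fin fineK; first exact: A_balanced.
by apply: fin_num_measure; exact: A_rv.
Qed.

Lemma measurable_point (M : 'M['F_p]_n) : measurable (A @^-1` [set M]).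
Proof.
have -> : (A @^-1` [set M] =
    \bigcap_(k in [set: 'I_n * 'I_n]) ((fun w => A w k.1 k.2) @^-1` [set M k.1 k.2])).
  apply/seteqP; split => w /= => [e k _|h]; first (by rewrite /= e); apply/matrixP => i j.
  exact: (h (i, j) I).
apply: fin_bigcap_measurable => [|k _]; first exact: finite_finset.
exact: A_rv.
Qed.

Lemma prob_point (M : 'M['F_p]_n) :
  fine (P (A @^-1` [set M])) = mx_weight entry_law M.
Proof.
(* Independence for the full family of entries and singleton events gives the product weight. *)
have := A_indep [set: _]%SET (fun k => [set M k.1 k.2]).
have -> : [set w | forall k, k \in [set: 'I_n * 'I_n]%SET ->
    [set M k.1 k.2] (A w k.1 k.2)] = (A @^-1` [set M]).
  apply/seteqP; split => w /= => [h|-> //]; apply/matrixP => i j.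
  by have := h (i, j); rewrite inE => /(_ isT).
move=> ->; rewrite /mx_weight /entry_law exchange_big pair_big /=.
by apply: eq_bigl => k; rewrite inE.
Qed.

Lemma prob_matrix (Q : pred 'M['F_p]_n) :
  P [set w | Q (A w)] = (expect entry_law (fun M => (Q M)%:R))%:E.
Proof.
have -> : [set w | Q (A w)] = (A @^-1` [set M | Q M]) by [].
rewrite prob_finite; last exact: measurable_point.
congr EFin; rewrite big_mkcond; apply: eq_bigr => M _.
by rewrite prob_point; case: (Q M); rewrite ?mulr1 ?mulr0.
Qed.

End FiniteLaw.

Theorem corollary1p2 (R : realType) (p : nat) (p_prime : prime p)
    (eps : R) (eps_gt0 : 0 < eps) (eps_le : eps <= 1 - p%:R^-1)
    (d : nat -> measure_display) (T : forall n : nat, measurableType (d n))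
    (P : forall n : nat, probability (T n) R)
    (A : forall n : nat, T n -> 'M['F_p]_n)
    (A_rv : forall (n : nat) (i j : 'I_n), (0 < n)%N ->
      random_element (fun w => A n w i j))
    (A_balanced : forall (n : nat) (i j : 'I_n), (0 < n)%N ->
      balanced (P n) eps (fun w => A n w i j))
    (A_indep : forall n : nat, (0 < n)%N ->
      mutually_independent (P n)
        (fun (ij : 'I_n * 'I_n) w => A n w ij.1 ij.2))
    (r : nat) (f : 'I_r -> {poly 'F_p}) (f_inj : injective f)
    (f_monic : forall i, f i \is monic)
    (f_irr : forall i, irreducible_poly (f i))
    (j : 'I_r -> nat) :
  P n [set w | forall i, multiplicity (f i) (char_poly (A n w)) = j i]
    @[n --> \oo] --> (\prod_(i < r) nu R (f i) (j i))%:E.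
Proof.
have eps_le1 : eps <= 1 by rewrite (le_trans eps_le) // gerBl invr_ge0.
have f_mi i : monic_irr (f i) by split.
have eqP n : (0 < n)%N ->
    P n [set w | forall i, multiplicity (f i) (char_poly (A n w)) = j i] =
    (expect (entry_law (P n) (A n)) (fun M => (of_type f j M)%:R))%:E.
  move=> n0; rewrite -prob_matrix; first last.
  - exact: A_indep.
  - by move=> i k; exact: A_rv.
  congr (P n _); apply/seteqP.
  by split=> w /= h; apply/(multiplicity_type j (A n w) f_inj f_mi).
(* The matrix count contributes the [gam] factors and the absence of torsion the Euler products;
   [nuE] identifies their product with [nu]. *)
have limE : \prod_(i < r) nu R (f i) (j i) =
    char_count R (type_dim f j) (type_poly f j) * \prod_i euler_lim R f i.
  rewrite char_count_prod ?index_enum_uniq // -big_split; apply: eq_bigr => i _ /=.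
  rewrite nuE //; last by case: (f_irr i).
  by rewrite residue_cardE.
rewrite limE; apply: cvg_EFin.
  near=> n; rewrite eqP //.
  by near: n; exists 1%N.
apply/cvgrPdist_le => t t0.
have [N HN] := uconv_of_type p_prime eps_gt0 eps_le1 j f_inj f_mi t0.
near=> n; have n0 : (0 < n)%N by near: n; exists 1%N.
rewrite /= eqP // distrC /=; apply: HN; first by near: n; exists N.
move=> k; apply: entry_law_valid => i l; first exact: A_rv.
exact: A_balanced.
Unshelve. all: by end_near. Qed.
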